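(* (1) For every bsi-rule system $\mathtt{L}$, the tense companions of $\mathtt{L}$ form the interval $\{\mathtt{M}\in\mathbf{NExt}(\mathtt{S4.t_R}):\tau\mathtt{L}\subseteq\mathtt{M}\subseteq\sigma\mathtt{L}\}$. (2) For every bsi-logic $\mathtt{L}$, the tense companions of $\mathtt{L}$ form the interval $\{\mathtt{M}\in\mathbf{NExt}(\mathtt{S4.t}):\tau\mathtt{L}\subseteq\mathtt{M}\subseteq\sigma\mathtt{L}\}$.
   Context: Bsi-logics: substitution-closed sets of formulae over $\{\land,\lor,\to,\leftarrow,\bot,\top\}$ containing $\mathtt{bi\text{-}IPC}$, closed under modus ponens and $\varphi\mapsto\neg(\varphi\leftarrow\top)$. Bsi-rule systems: rule systems (sets of pairs $\Gamma/\Delta$ of finite sets of formulae closed under substitution, reflexivity, weakening on both sides and cut) containing $/\varphi$ for all $\varphi\in\mathtt{bi\text{-}IPC}$, $\varphi,\varphi\to\psi/\psi$, $\varphi/\neg(\varphi\leftarrow\top)$. Tense logics: substitution-closed sets over $\{\land,\lor,\neg,\square_F,\lozenge_P,\bot,\top\}$ containing $\mathtt{S4.t}$ (the least normal tense logic with $\mathtt{S4}$ for $\square_F$ and for $\square_P=\neg\lozenge_P\neg$ and $\varphi\to\square_F\lozenge_P\varphi$), closed under modus ponens and necessitation for $\square_F,\square_P$; $\mathbf{NExt}(\mathtt{S4.t})$ is the set of all tense logics. Tense rule systems: rule systems containing $/\varphi$ for $\varphi\in\mathtt{S4.t}$, $\varphi,\varphi\to\psi/\psi$, $\varphi/\square_F\varphi$,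 $\varphi/\square_P\varphi$; $\mathbf{NExt}(\mathtt{S4.t_R})$ is the set of all of them. $\mathtt{GRZ.T}=\mathtt{S4.t}\oplus\square_F(\square_F(p\to\square_Fp)\to p)\to p\oplus p\to\lozenge_P(p\land\neg\lozenge_P(\lozenge_Pp\land\neg p))$; $\mathtt{X_R}$ is the least tense rule system containing $/\varphi$ for $\varphi\in\mathtt{X}$. Translation $T$: $T(p)=\square_Fp$, $T(\bot)=\bot,T(\top)=\top$, commutes with $\land,\lor$, $T(\varphi\to\psi)=\square_F(\neg T\varphi\lor T\psi)$, $T(\varphi\leftarrow\psi)=\lozenge_P(T\varphi\land\neg T\psi)$, $T(\Gamma/\Delta)=T[\Gamma]/T[\Delta]$. For rule systems: $\tau\mathtt{L}=\mathtt{S4.t_R}\oplus\{T(\Gamma/\Delta):\Gamma/\Delta\in\mathtt{L}\}$, $\sigma\mathtt{L}=\mathtt{GRZ.T_R}\oplus\tau\mathtt{L}$; for logics $\tau\mathtt{L}=\mathtt{S4.t}\oplus\{T\varphi:\varphi\in\mathtt{L}\}$, $\sigma\mathtt{L}=\mathtt{GRZ.T}\oplus\{T\varphi:\varphi\in\mathtt{L}\}$ ($\oplus$ = least tense logic/rule system containing the sets). A tense rule system $\mathtt{M}$ is a tense companion of a bsi-rule system $\mathtt{L}$ if for every bsi rule $\Gamma/\Delta$: $\Gamma/\Delta\in\mathtt{L}$ iff $T(\Gamma/\Delta)\in\mathtt{M}$; a tense logic $\mathtt{M}$ is a tense companion of a bsi-logic $\mathtt{L}$ if $\varphi\in\mathtt{L}$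 iff $T(\varphi)\in\mathtt{M}$.
   Formalization: The closure condition φ ↦ ¬(φ←⊤) for bsi-logics and the rule φ/¬(φ←⊤) for bsi-rule systems are corrected to ¬(⊤←φ); as printed the condition is vacuous and the claim fails for systems not closed under the corrected rule. *)

(* Defs.v *)
From HB Require Import structures.
From mathcomp Require Import all_boot finmap.
From mathcomp Require Import boolp classical_sets.

Set Implicit Arguments.
Unset Strict Implicit.
Unset Printing Implicit Defensive.

Local Open Scope fset_scope.
Local Open Scope classical_set_scope.

(** * Formulae *)

(* [bCoimp a b] is the co-implication a <- b, read "a but not b": in bi-Heyting
   algebras it is the residual (a <- b) <= c iff a <= b \/ c. *)
Inductive bform : Type :=
| bVar of nat
| bBot
| bTop
| bAnd of bform & bform
| bOr of bform & bform
| bImp of bform & bform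
| bCoimp of bform & bform.

Inductive tform : Type :=
| tVar of nat
| tBot
| tTop
| tNeg of tform
| tAnd of tform & tform
| tOr of tform & tform
| tBoxF of tform
| tDiaP of tform.

(* Encodings into trees, giving formulae the choiceType structure that finite
   sets of formulae require. *)
Fixpoint bform_encode (a : bform) : GenTree.tree nat :=
  match a with
  | bVar n => GenTree.Leaf n
  | bBot => GenTree.Node 0 [::]
  | bTop => GenTree.Node 1 [::]
  | bAnd a b => GenTree.Node 2 [:: bform_encode a; bform_encode b]
  | bOr a b => GenTree.Node 3 [:: bform_encode a; bform_encode b]
  | bImp a b => GenTree.Node 4 [:: bform_encode a; bform_encode b]
  | bCoimp a b => GenTree.Node 5 [:: bform_encode a; bform_encode b]
  end.

Fixpoint bform_decode (t : GenTree.tree nat) : bform :=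
  match t with
  | GenTree.Leaf n => bVar n
  | GenTree.Node 1 [::] => bTop
  | GenTree.Node 2 [:: t; u] => bAnd (bform_decode t) (bform_decode u)
  | GenTree.Node 3 [:: t; u] => bOr (bform_decode t) (bform_decode u)
  | GenTree.Node 4 [:: t; u] => bImp (bform_decode t) (bform_decode u)
  | GenTree.Node 5 [:: t; u] => bCoimp (bform_decode t) (bform_decode u)
  | GenTree.Node _ _ => bBot
  end.

Lemma bform_encodeK : cancel bform_encode bform_decode.
Proof. by elim=> //= a -> b ->. Qed.

HB.instance Definition _ := Countable.copy bform (can_type bform_encodeK).

Fixpoint tform_encode (a : tform) : GenTree.tree nat :=
  match a with
  | tVar n => GenTree.Leaf n
  | tBot => GenTree.Node 0 [::]
  | tTop => GenTree.Node 1 [::]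
  | tNeg a => GenTree.Node 2 [:: tform_encode a]
  | tAnd a b => GenTree.Node 3 [:: tform_encode a; tform_encode b]
  | tOr a b => GenTree.Node 4 [:: tform_encode a; tform_encode b]
  | tBoxF a => GenTree.Node 5 [:: tform_encode a]
  | tDiaP a => GenTree.Node 6 [:: tform_encode a]
  end.

Fixpoint tform_decode (t : GenTree.tree nat) : tform :=
  match t with
  | GenTree.Leaf n => tVar n
  | GenTree.Node 1 [::] => tTop
  | GenTree.Node 2 [:: t] => tNeg (tform_decode t)
  | GenTree.Node 3 [:: t; u] => tAnd (tform_decode t) (tform_decode u)
  | GenTree.Node 4 [:: t; u] => tOr (tform_decode t) (tform_decode u)
  | GenTree.Node 5 [:: t] => tBoxF (tform_decode t)
  | GenTree.Node 6 [:: t] => tDiaP (tform_decode t)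
  | GenTree.Node _ _ => tBot
  end.

Lemma tform_encodeK : cancel tform_encode tform_decode.
Proof. by elim=> //= [a -> | a -> b -> | a -> b -> | a -> | a ->]. Qed.

HB.instance Definition _ := Countable.copy tform (can_type tform_encodeK).

Definition bNeg (a : bform) : bform := bImp a bBot.

Definition tImp (a b : tform) : tform := tOr (tNeg a) b.
Definition tIff (a b : tform) : tform := tAnd (tImp a b) (tImp b a).
Definition tDiaF (a : tform) : tform := tNeg (tBoxF (tNeg a)).
Definition tBoxP (a : tform) : tform := tNeg (tDiaP (tNeg a)).

Fixpoint bsubst (s : nat -> bform) (a : bform) : bform :=
  match a with
  | bVar n => s n
  | bBot => bBot
  | bTop => bTop
  | bAnd a b => bAnd (bsubst s a) (bsubst s b)
  | bOr a b => bOr (bsubst s a) (bsubst s b)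
  | bImp a b => bImp (bsubst s a) (bsubst s b)
  | bCoimp a b => bCoimp (bsubst s a) (bsubst s b)
  end.

Fixpoint tsubst (s : nat -> tform) (a : tform) : tform :=
  match a with
  | tVar n => s n
  | tBot => tBot
  | tTop => tTop
  | tNeg a => tNeg (tsubst s a)
  | tAnd a b => tAnd (tsubst s a) (tsubst s b)
  | tOr a b => tOr (tsubst s a) (tsubst s b)
  | tBoxF a => tBoxF (tsubst s a)
  | tDiaP a => tDiaP (tsubst s a)
  end.

(** * Rule systems *)

(* The pair (G, D) is the multi-conclusion rule G / D. *)
Definition rule (F : choiceType) : Type := ({fset F} * {fset F})%type.

Definition map_rule (F1 F2 : choiceType) (f : F1 -> F2) (r : rule F1) :
  rule F2 := ([fset f a | a in r.1], [fset f a | a in r.2]).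

Definition axiom_rule (F : choiceType) (a : F) : rule F := (fset0, [fset a]).

Record rule_system (F : choiceType) (subst : (nat -> F) -> F -> F)
    (S : set (rule F)) : Prop := {
  rs_subst : forall s r, S r -> S (map_rule (subst s) r);
  rs_refl : forall a : F, S ([fset a], [fset a]);
  rs_weak : forall G G' D D' : {fset F},
    S (G, D) -> S (G `|` G', D `|` D')%fset;
  rs_cut : forall (G D : {fset F}) (a : F),
    S (G, D `|` [fset a])%fset -> S (G `|` [fset a], D)%fset -> S (G, D) }.

(** * Bi-superintuitionistic logics and rule systems *)

(* Rauszer's Hilbert calculus for bi-intuitionistic logic. *)
Inductive biIPC : set bform :=
| biIPC_K a b : biIPC (bImp a (bImp b a))
| biIPC_S a b c :
    biIPC (bImp (bImp a (bImp b c)) (bImp (bImp a b) (bImp a c)))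
| biIPC_andl a b : biIPC (bImp (bAnd a b) a)
| biIPC_andr a b : biIPC (bImp (bAnd a b) b)
| biIPC_and a b : biIPC (bImp a (bImp b (bAnd a b)))
| biIPC_orl a b : biIPC (bImp a (bOr a b))
| biIPC_orr a b : biIPC (bImp b (bOr a b))
| biIPC_or a b c :
    biIPC (bImp (bImp a c) (bImp (bImp b c) (bImp (bOr a b) c)))
| biIPC_bot a : biIPC (bImp bBot a)
| biIPC_top : biIPC bTop
| biIPC_co1 a b : biIPC (bImp a (bOr b (bCoimp a b)))
| biIPC_co2 a b : biIPC (bImp (bCoimp a b) (bCoimp bTop (bImp a b)))
| biIPC_co3 a b c : biIPC (bImp (bCoimp (bCoimp a b) c) (bCoimp a (bOr b c)))
| biIPC_co4 a b : biIPC (bImp (bNeg (bCoimp a b)) (bImp a b))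
| biIPC_mp a b : biIPC a -> biIPC (bImp a b) -> biIPC b
| biIPC_dn a : biIPC a -> biIPC (bNeg (bCoimp bTop a)).

(* [bsi_dn] and [bsi_rs_dn]: with a <- b read "a but not b", the
   necessitation-like rule of bi-intuitionistic logic is a / ~(T <- a) (the
   co-negation of a is refuted). The rule is sometimes displayed with the
   operands of <- exchanged, but ~(a <- T) is a theorem for every a. *)
Record bsi_logic (L : set bform) : Prop := {
  bsi_subst : forall s a, L a -> L (bsubst s a);
  bsi_biIPC : biIPC `<=` L;
  bsi_mp : forall a b, L a -> L (bImp a b) -> L b;
  bsi_dn : forall a, L a -> L (bNeg (bCoimp bTop a)) }.

Record bsi_rule_system (L : set (rule bform)) : Prop := {
  bsi_rs : rule_system bsubst L;
  bsi_rs_biIPC : forall a, biIPC a -> L (axiom_rule a);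
  bsi_rs_mp : forall a b : bform, L ([fset a; bImp a b], [fset b]);
  bsi_rs_dn : forall a : bform, L ([fset a], [fset bNeg (bCoimp bTop a)]) }.

(** * Tense logics and rule systems *)

(* Formulae whose main connective is modal are evaluated as atoms. *)
Fixpoint tval (v : tform -> bool) (a : tform) : bool :=
  match a with
  | tBot => false
  | tTop => true
  | tNeg a => ~~ tval v a
  | tAnd a b => tval v a && tval v b
  | tOr a b => tval v a || tval v b
  | tVar _ | tBoxF _ | tDiaP _ => v a
  end.

Definition tautology (a : tform) : Prop := forall v, tval v a.

(* The duality axiom [ntl_dual] is needed because the primitive past operator
   is the diamond; [ntl_convF] and [ntl_convP] are the two tense axioms making
   the future and past modalities converse to each other. *)
Record normal_tense_logic (L : set tform) : Prop := {
  ntl_subst : forall s a, L a -> L (tsubst s a);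
  ntl_taut : forall a, tautology a -> L a;
  ntl_KF : forall a b, L (tImp (tBoxF (tImp a b)) (tImp (tBoxF a) (tBoxF b)));
  ntl_KP : forall a b, L (tImp (tBoxP (tImp a b)) (tImp (tBoxP a) (tBoxP b)));
  ntl_dual : forall a, L (tIff (tDiaP a) (tNeg (tBoxP (tNeg a))));
  ntl_convF : forall a, L (tImp a (tBoxF (tDiaP a)));
  ntl_convP : forall a, L (tImp a (tBoxP (tDiaF a)));
  ntl_mp : forall a b, L a -> L (tImp a b) -> L b;
  ntl_necF : forall a, L a -> L (tBoxF a);
  ntl_necP : forall a, L a -> L (tBoxP a) }.

Inductive S4t_axiom : set tform :=
| S4t_TF a : S4t_axiom (tImp (tBoxF a) a)
| S4t_4F a : S4t_axiom (tImp (tBoxF a) (tBoxF (tBoxF a)))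
| S4t_TP a : S4t_axiom (tImp (tBoxP a) a)
| S4t_4P a : S4t_axiom (tImp (tBoxP a) (tBoxP (tBoxP a))).

Definition S4t : set tform := smallest normal_tense_logic S4t_axiom.

(* Membership in NExt(S4.t). *)
Record tense_logic (L : set tform) : Prop := {
  tl_subst : forall s a, L a -> L (tsubst s a);
  tl_S4t : S4t `<=` L;
  tl_mp : forall a b, L a -> L (tImp a b) -> L b;
  tl_necF : forall a, L a -> L (tBoxF a);
  tl_necP : forall a, L a -> L (tBoxP a) }.

(* Membership in NExt(S4.t_R). *)
Record tense_rule_system (L : set (rule tform)) : Prop := {
  tl_rs : rule_system tsubst L;
  tl_rs_S4t : forall a, S4t a -> L (axiom_rule a);
  tl_rs_mp : forall a b : tform, L ([fset a; tImp a b], [fset b]);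
  tl_rs_necF : forall a : tform, L ([fset a], [fset tBoxF a]);
  tl_rs_necP : forall a : tform, L ([fset a], [fset tBoxP a]) }.

Definition tl_join (X Y : set tform) : set tform :=
  smallest tense_logic (X `|` Y).

Definition tl_rs_join (X Y : set (rule tform)) : set (rule tform) :=
  smallest tense_rule_system (X `|` Y).

(* The rule system X_R of a tense logic X. *)
Definition rs_of_logic (X : set tform) : set (rule tform) :=
  smallest tense_rule_system [set axiom_rule a | a in X].

Definition GRZ_F : tform :=
  let p := tVar 0 in
  tImp (tBoxF (tImp (tBoxF (tImp p (tBoxF p))) p)) p.

Definition GRZ_P : tform :=
  let p := tVar 0 in
  tImp p (tDiaP (tAnd p (tNeg (tDiaP (tAnd (tDiaP p) (tNeg p)))))).

Definition GRZT : set tform := tl_join (tl_join S4t [set GRZ_F]) [set GRZ_P].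

(** * Goedel translation and tense companions *)

Fixpoint T (a : bform) : tform :=
  match a with
  | bVar n => tBoxF (tVar n)
  | bBot => tBot
  | bTop => tTop
  | bAnd a b => tAnd (T a) (T b)
  | bOr a b => tOr (T a) (T b)
  | bImp a b => tBoxF (tOr (tNeg (T a)) (T b))
  | bCoimp a b => tDiaP (tAnd (T a) (tNeg (T b)))
  end.

Definition tau_rs (L : set (rule bform)) : set (rule tform) :=
  tl_rs_join (rs_of_logic S4t) (map_rule T @` L).

Definition sigma_rs (L : set (rule bform)) : set (rule tform) :=
  tl_rs_join (rs_of_logic GRZT) (tau_rs L).

Definition tau_logic (L : set bform) : set tform := tl_join S4t (T @` L).

Definition sigma_logic (L : set bform) : set tform := tl_join GRZT (T @` L).

Definition tense_companion_rs (L : set (rule bform)) (M : set (rule tform)) :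
  Prop := tense_rule_system M /\ forall r, L r <-> M (map_rule T r).

Definition tense_companion_logic (L : set bform) (M : set tform) : Prop :=
  tense_logic M /\ forall a, L a <-> M (T a).

(* Main.v *)
Require Import Defs.
From mathcomp Require Import all_boot finmap.
From mathcomp Require Import boolp classical_sets.

Set Implicit Arguments.
Unset Strict Implicit.
Unset Printing Implicit Defensive.

Local Open Scope classical_set_scope.

(* Every rule system, and the local consequence relation of every (bi-)theory, is
   a Scott relation, so one prime extension lemma yields Kripke models on both
   sides. If the rule r is not in L, prime theories of a saturated set of
   bi-formulae refuting r form a preorder; the Boolean combinations of its
   definable upsets are closed under the tense modalities and validate the
   Grzegorczyk axioms, because along the preorder such a set changes only when
   one of finitely many upsets is entered. Hence sigma L is conservative over L.

   Conversely, let M be a companion of L. In a Grzegorczyk model, give each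
   variable at w its old value if the truth values of the variables are constant
   among the points above (or among those below) w satisfying the same relevant
   modal formulae, and otherwise a default value depending only on those modal
   formulae. The Grzegorczyk axioms provide enough constant points for this not
   to alter the modal formulae. The new values are Boolean combinations of modal
   formulae, so up to global equivalence over GRZ.T every formula a is an instance
   of a translation T b, where b is obtained from an instance of a. This puts
   every rule of M in sigma L. *)

(** * Scott relations and prime sets *)

(** Finitary multi-conclusion consequence. Weakening is stated through membership, so that sequences
    behave as finite sets. *)
Record scott (F : eqType) (E : seq F -> seq F -> Prop) : Prop := {
  scott_refl : forall a, E [:: a] [:: a];
  scott_weak : forall G G' D D',
    {subset G <= G'} -> {subset D <= D'} -> E G D -> E G' D';
  scott_cut : forall G D a, E G (a :: D) -> E (a :: G) D -> E G D }.

Definition prime_set (F : eqType) (E : seq F -> seq F -> Prop) (w : F -> bool) :=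
  forall G D, E G D -> all w G -> has w D.

(** Lindenbaum's lemma: enlarge [G0] to a maximal set that entails no finite part of [D0]. By
    maximality each formula outside it entails, with its help, a finite part of [D0], so finitely
    many outside formulae can be cut away one at a time. *)
Lemma scott_prime_ext (F : eqType) (E : seq F -> seq F -> Prop)
    (G0 D0 : set F) :
  scott E ->
  (forall G D, (forall a, a \in G -> G0 a) -> (forall a, a \in D -> D0 a) ->
     ~ E G D) ->
  exists w : F -> bool, [/\ prime_set E w,
    forall a, G0 a -> w a & forall a, D0 a -> ~~ w a].
Proof.
move=> Es cons0.
pose fin (S : set F) (s : seq F) := forall a, a \in s -> S a.
(* [G0] is built into [P] because Zorn's lemma also requires [P] of the union of the empty chain. *)
pose P (X : set F) := forall G D, fin (G0 `|` X) G -> fin D0 D -> ~ E G D.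
have [C CP Ctot|X [PX Xmax]] := @Zorn_bigcup F P.
  move=> G D finG finD.
  suff [fG|[Y CY fG]] : fin G0 G \/ exists2 Y, C Y & fin (G0 `|` Y) G.
  - exact: cons0.
  - exact: (CP Y CY).
  elim: G finG => [|a G IH] finG; first by left.
  have {}IH := IH (fun b bG => finG b (mem_behead (s := a :: G) bG)).
  have [G0a|[Y CY Ya]] := finG a (mem_head _ _).
    case: IH => [fG|[Y CY fG]]; [left|right; exists Y => //] => b.
      by rewrite inE => /orP[/eqP->|/fG].
    by rewrite inE => /orP[/eqP->|/fG //]; left.
  right; case: IH => [fG|[Z CZ fG]].
    exists Y => // b; rewrite inE => /orP[/eqP->|/fG]; by [right|left].
  have [YZ|ZY] := Ctot _ _ CY CZ.
    exists Z => // b; rewrite inE => /orP[/eqP->|/fG //]; right; exact: YZ.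
  exists Y => // b; rewrite inE => /orP[/eqP->|/fG]; first by right.
  by case=> [|/ZY]; [left|right].
pose w := G0 `|` X.
have out a : ~ w a -> exists G D, [/\ fin w G, fin D0 D & E (a :: G) D].
  move=> nwa; apply: contrapT => no.
  apply: (Xmax (X `|` [set a])); first split.
  - by move=> x Xx; left.
  - by move=> /(_ a (or_intror erefl)) Xa; apply: nwa; right.
  move=> G D fG fD EGD; apply: no.
  exists [seq x <- G | x != a], D; split=> // [x|].
    rewrite mem_filter => /andP[xa /fG].
    by case=> [|[|/eqP]]; [left|right|rewrite (negbTE xa)].
  apply: (scott_weak Es _ _ EGD) => // x xG.
  by rewrite inE mem_filter; case: eqP.
exists (fun a => `[< w a >]); split.
(* [D1] collects the formulae of [D0] that the successive cuts leave behind. *)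
- suff aux D : (forall a, a \in D -> ~ w a) -> forall G D1,
      fin w G -> fin D0 D1 -> ~ E G (D ++ D1).
    move=> G D EGD /allP wG; apply: contrapT => /negP/hasPn nD.
    apply: (aux D _ G [::]) => //; last by rewrite cats0.
      by move=> a aD; apply/asboolPn/nD.
    by move=> a /wG /asboolP.
  elim: D => [|d D IH] nD G D1 fG fD1; first exact: PX.
  have [Gd [Dd [fGd fDd Ed]]] := out d (nD d (mem_head _ _)).
  move=> EGD; apply: (IH _ (G ++ Gd) (D1 ++ Dd)).
  + by move=> a aD; apply: nD; rewrite inE aD orbT.
  + by move=> a; rewrite mem_cat => /orP[/fG|/fGd].
  + by move=> a; rewrite mem_cat => /orP[/fD1|/fDd].
  apply: (scott_cut Es (a := d)).
    apply: (scott_weak Es _ _ EGD) => x; rewrite ?inE !mem_cat.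
      by move=> ->.
    by move=> /or3P[]->; rewrite ?orbT.
  apply: (scott_weak Es _ _ Ed) => x; rewrite ?inE !mem_cat.
    by move=> /orP[]->; rewrite ?orbT.
  by move=> ->; rewrite !orbT.
- by move=> a G0a; apply/asboolP; left.
- move=> a D0a; apply/asboolPn => wa.
  apply: (PX [:: a] [:: a]); last exact: scott_refl Es _.
    by move=> b; rewrite inE => /eqP->.
  by move=> b; rewrite inE => /eqP->.
Qed.

(** * Rule systems as Scott relations *)

Definition fset_of (F : choiceType) (s : seq F) : {fset F} :=
  [fset a in s]%fset.

Lemma in_fset_of (F : choiceType) (s : seq F) : fset_of s =i s.
Proof. by move=> x; rewrite !inE. Qed.

Lemma fset_ofK (F : choiceType) (G : {fset F}) : fset_of (enum_fset G) = G.
Proof. by apply/fsetP=> x; rewrite in_fset_of. Qed.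

Lemma rule_system_scott (F : choiceType) subst (S : set (rule F)) :
  rule_system subst S ->
  scott (fun G D : seq F => S (fset_of G, fset_of D)).
Proof.
case=> _ rf wk ct; split=> [a|G G' D D' GG DD SGD|G D a S1 S2].
- by have := rf a; rewrite /fset_of !fset_cons !fset_nil !fsetU0.
- suff -> : (fset_of G', fset_of D') =
    (fset_of G `|` fset_of G', fset_of D `|` fset_of D')%fset
    by exact: wk.
  congr pair; apply/esym/fsetUidPr/fsubsetP => x; rewrite !in_fset_of.
    exact: GG.
  exact: DD.
- by apply: (ct _ _ a); rewrite fsetUC -?fset_cons // /fset_of -fset_cons.
Qed.

Lemma rule_system_ext (F : choiceType) subst (S : set (rule F)) (r : rule F) :
  rule_system subst S -> ~ S r ->
  exists X : F -> bool, [/\ forall a, a \in r.1 -> X a,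
    forall a, a \in r.2 -> ~~ X a
    & forall q, S q -> (forall a, a \in q.1 -> X a) -> exists2 d, d \in q.2 & X d].
Proof.
case: r => G0 D0 Srs nS.
have Es := rule_system_scott Srs.
have [G D GG DD|X [Xp XG XD]] :=
    scott_prime_ext (G0 := [set a | a \in G0]) (D0 := [set a | a \in D0]) Es.
  move=> /(scott_weak Es (G' := enum_fset G0) (D' := enum_fset D0) GG DD) /=.
  by rewrite !fset_ofK.
exists X; split=> // -[G D] /= Sq GX.
apply/hasP; apply: (Xp (enum_fset G) (enum_fset D)); last exact/allP.
by rewrite !fset_ofK.
Qed.

Local Notation tval := Defs.tval.

(** * Kripke models of tense theories *)

(** Truth is a primitive relation [m] instead of being computed from a valuation, so that
    precomposing with a substitution gives a model again. *)
Record tmodel (W : Type) (R : W -> W -> Prop) (m : W -> tform -> bool) : Prop := {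
  tm_refl : forall w, R w w;
  tm_trans : forall v u w, R u v -> R v w -> R u w;
  tm_bot : forall w, m w tBot = false;
  tm_top : forall w, m w tTop = true;
  tm_neg : forall w a, m w (tNeg a) = ~~ m w a;
  tm_and : forall w a b, m w (tAnd a b) = m w a && m w b;
  tm_or : forall w a b, m w (tOr a b) = m w a || m w b;
  tm_boxF : forall w a, m w (tBoxF a) <-> forall v, R w v -> m v a;
  tm_diaP : forall w a, m w (tDiaP a) <-> exists2 v, R v w & m v a }.

Lemma tmodel_subst W (R : W -> W -> Prop) m s :
  tmodel R m -> tmodel R (fun w a => m w (tsubst s a)).
Proof.
by case=> *; split=> //= *; eauto.
Qed.

Section TmodelFacts.
Variables (W : Type) (R : W -> W -> Prop) (m : W -> tform -> bool).
Hypothesis mR : tmodel R m.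

Lemma tm_imp w a b : m w (tImp a b) = (m w a ==> m w b).
Proof. by rewrite (tm_or mR) (tm_neg mR) implybE. Qed.

Lemma tm_boxP w a : m w (tBoxP a) <-> forall v, R v w -> m v a.
Proof.
rewrite (tm_neg mR); split=> [/negP nd v vw|all].
  apply/negPn/negP => na; apply/nd/(tm_diaP mR); exists v => //.
  by rewrite (tm_neg mR).
by apply/negP => /(tm_diaP mR)[v /all]; rewrite (tm_neg mR) => ->.
Qed.

Lemma tm_diaF w a : m w (tDiaF a) <-> exists2 v, R w v & m v a.
Proof.
rewrite (tm_neg mR); split=> [/negP nb|[v wv va]].
  apply: contrapT => no; apply: nb; apply/(tm_boxF mR) => v wv.
  by rewrite (tm_neg mR); apply/negP => va; apply: no; exists v.
apply/negP => /(tm_boxF mR)/(_ v wv).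
by rewrite (tm_neg mR) va.
Qed.

Lemma tm_tval w a : m w a = tval (m w) a.
Proof.
elim: a => //= [||a <-|a <- b <-|a <- b <-].
- exact: tm_bot mR w.
- exact: tm_top mR w.
- exact: tm_neg mR w a.
- exact: tm_and mR w a b.
- exact: tm_or mR w a b.
Qed.

End TmodelFacts.

Definition tvalid (a : tform) : Prop :=
  forall W (R : W -> W -> Prop) m, tmodel R m -> forall w, m w a.

Lemma S4t_sound : S4t `<=` tvalid.
Proof.
apply: smallest_sub; first split.
- by move=> s a va W R m /(tmodel_subst s) /va.
- by move=> a ta W R m mR w; rewrite (tm_tval mR).
- move=> a b W R m mR w; rewrite !(tm_imp mR); apply/implyP => /(tm_boxF mR) ab.
  apply/implyP => /(tm_boxF mR) ba; apply/(tm_boxF mR) => v wv.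
  by have := ab _ wv; rewrite (tm_imp mR) ba.
- move=> a b W R m mR w; rewrite !(tm_imp mR); apply/implyP => /(tm_boxP mR) ab.
  apply/implyP => /(tm_boxP mR) ba; apply/(tm_boxP mR) => v wv.
  by have := ab _ wv; rewrite (tm_imp mR) ba.
- move=> a W R m mR w; rewrite (tm_and mR) !(tm_imp mR) !(tm_neg mR) !negbK.
  suff -> : m w (tDiaP (tNeg (tNeg a))) = m w (tDiaP a) by rewrite implybb.
  by apply/idP/idP => /(tm_diaP mR)[v vw]; rewrite ?(tm_neg mR) ?negbK => va;
     apply/(tm_diaP mR); exists v; rewrite // !(tm_neg mR) negbK.
- move=> a W R m mR w; rewrite (tm_imp mR); apply/implyP => wa.
  by apply/(tm_boxF mR) => v wv; apply/(tm_diaP mR); exists w.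
- move=> a W R m mR w; rewrite (tm_imp mR); apply/implyP => wa.
  by apply/(tm_boxP mR) => v wv; apply/(tm_diaF mR); exists w.
- move=> a b va vab W R m mR w; have := vab _ _ _ mR w.
  by rewrite (tm_imp mR) (va _ _ _ mR).
- by move=> a va W R m mR w; apply/(tm_boxF mR) => v _; apply: va mR v.
- by move=> a va W R m mR w; apply/(tm_boxP mR) => v _; apply: va mR v.
move=> _ [] a W R m mR w; rewrite (tm_imp mR); apply/implyP.
- by move/(tm_boxF mR); apply; apply: tm_refl mR w.
- move/(tm_boxF mR) => wa; apply/(tm_boxF mR) => v wv; apply/(tm_boxF mR) => u vu.
  exact/wa/(tm_trans mR wv).
- by move/(tm_boxP mR); apply; apply: tm_refl mR w.
- move/(tm_boxP mR) => wa; apply/(tm_boxP mR) => v wv; apply/(tm_boxP mR) => u vu.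
  exact/wa/(tm_trans mR vu).
Qed.

Lemma S4t_normal : normal_tense_logic S4t.
Proof.
split.
- by move=> s a La Y Yn; apply: (ntl_subst Yn.1); apply: La.
- by move=> a ta Y Yn; apply: (ntl_taut Yn.1).
- by move=> a b Y Yn; apply: (ntl_KF Yn.1).
- by move=> a b Y Yn; apply: (ntl_KP Yn.1).
- by move=> a Y Yn; apply: (ntl_dual Yn.1).
- by move=> a Y Yn; apply: (ntl_convF Yn.1).
- by move=> a Y Yn; apply: (ntl_convP Yn.1).
- by move=> a b La Lab Y Yn; apply: (ntl_mp Yn.1) (La _ Yn) (Lab _ Yn).
- by move=> a La Y Yn; apply: (ntl_necF Yn.1) (La _ Yn).
- by move=> a La Y Yn; apply: (ntl_necP Yn.1) (La _ Yn).
Qed.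

Lemma S4t_ax : S4t_axiom `<=` S4t.
Proof. exact: sub_smallest. Qed.

(** Closure under substitution is left out, so that saturated sets obtained from rule systems are
    covered along with tense logics. *)
Record ttheory (Y : set tform) : Prop := {
  tt_S4t : S4t `<=` Y;
  tt_mp : forall a b, Y a -> Y (tImp a b) -> Y b;
  tt_necF : forall a, Y a -> Y (tBoxF a);
  tt_necP : forall a, Y a -> Y (tBoxP a) }.

Lemma tense_logic_theory Y : tense_logic Y -> ttheory Y.
Proof. by case. Qed.

Section Canonical.
Variable Y : set tform.
Hypothesis Yt : ttheory Y.

Definition tconj (G : seq tform) := foldr tAnd tTop G.
Definition tdisj (G : seq tform) := foldr tOr tBot G.

Lemma tval_conj v G : tval v (tconj G) = all (tval v) G.
Proof. by elim: G => //= a G ->. Qed.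

Lemma tval_disj v G : tval v (tdisj G) = has (tval v) G.
Proof. by elim: G => //= a G ->. Qed.

Lemma tt_taut a : tautology a -> Y a.
Proof. by move=> ta; apply: (tt_S4t Yt); apply: (ntl_taut S4t_normal). Qed.

Lemma tt_taut1 a b :
  (forall v, tval v a -> tval v b) -> Y a -> Y b.
Proof.
move=> ab Ya; apply: (tt_mp Yt Ya); apply: tt_taut => v /=.
by rewrite -implybE; apply/implyP/ab.
Qed.

Lemma tt_taut2 a b c :
  (forall v, tval v a -> tval v b -> tval v c) -> Y a -> Y b -> Y c.
Proof.
move=> abc Ya Yb; apply: (tt_mp Yt Yb); apply: tt_taut1 Ya => v va /=.
by rewrite -implybE; apply/implyP/abc.
Qed.

(** Local consequence over [Y]; its prime sets are the worlds of the canonical model. *)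
Definition tentails (G D : seq tform) : Prop := Y (tImp (tconj G) (tdisj D)).

Lemma tval_entails v G D :
  tval v (tImp (tconj G) (tdisj D)) = (all (tval v) G ==> has (tval v) D).
Proof. by rewrite /= tval_conj tval_disj implybE. Qed.

Lemma tentails_scott : scott tentails.
Proof.
split=> [a|G G' D D' GG DD|G D a]; rewrite /tentails.
- by apply: tt_taut => v; rewrite tval_entails /= andbT orbF implybb.
- apply: tt_taut1 => v; rewrite !tval_entails => /implyP GD.
  apply/implyP => /allP vG'; have /GD/hasP[d dD vd] : all (tval v) G.
    by apply/allP => x /GG /vG'.
  by apply/hasP; exists d => //; apply: DD.
- apply: tt_taut2 => v; rewrite !tval_entails /=.
  by case: (tval v a) (all _ G) => [] [].
Qed.

Definition tworld : Type := {w : tform -> bool | prime_set tentails w}.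

Definition tacc (w v : tworld) : Prop := forall a, sval w (tBoxF a) -> sval v a.

Section World.
Variable w : tworld.

Lemma tworld_sub a : Y a -> sval w a.
Proof.
move=> Ya; have := svalP w [::] [:: a]; rewrite /= orbF; apply=> //.
by apply: tt_taut1 Ya => v va; rewrite tval_entails /= va.
Qed.

Lemma tworld_mp a b : Y (tImp a b) -> sval w a -> sval w b.
Proof.
move=> Yab wa; have := svalP w [:: a] [:: b]; rewrite /= orbF andbT; apply=> //.
by apply: tt_taut1 Yab => v /=; rewrite andbT orbF.
Qed.

Lemma tworld_neg a : sval w (tNeg a) = ~~ sval w a.
Proof.
apply/idP/negP => [wna wa|/negP nwa].
  have := svalP w [:: a; tNeg a] [::]; rewrite /= wa wna => H.
  suff : false by []; apply: H => //.
  by apply: tt_taut => v; rewrite tval_entails /=; case: tval.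
have := svalP w [::] [:: a; tNeg a]; rewrite /= (negbTE nwa) orbF; apply=> //.
by apply: tt_taut => v; rewrite tval_entails /=; case: tval.
Qed.

Lemma tworld_and a b : sval w (tAnd a b) = sval w a && sval w b.
Proof.
apply/idP/andP => [wab|[wa wb]].
  by split; apply: tworld_mp wab; apply: tt_taut => v /=; do 2!case: tval.
have := svalP w [:: a; b] [:: tAnd a b]; rewrite /= wa wb orbF; apply=> //.
by apply: tt_taut => v; rewrite tval_entails /=; do 2!case: tval.
Qed.

Lemma tworld_or a b : sval w (tOr a b) = sval w a || sval w b.
Proof.
apply/idP/orP => [wab|[]]; last 2 first.
- by apply: tworld_mp; apply: tt_taut => v /=; do 2!case: tval.
- by apply: tworld_mp; apply: tt_taut => v /=; do 2!case: tval.
have := svalP w [:: tOr a b] [:: a; b]; rewrite /= wab orbF.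
move=> H; apply/orP; apply: H => //.
by apply: tt_taut => v; rewrite tval_entails /=; do 2!case: tval.
Qed.

Lemma tworld_imp a b : sval w (tImp a b) = (sval w a ==> sval w b).
Proof. by rewrite tworld_or tworld_neg implybE. Qed.

Lemma tworld_S4t a : S4t a -> sval w a.
Proof. by move=> /(tt_S4t Yt)/tworld_sub. Qed.

Lemma tworld_KF a b : sval w (tBoxF (tImp a b)) -> sval w (tBoxF a) -> sval w (tBoxF b).
Proof.
have := tworld_S4t (ntl_KF S4t_normal a b); rewrite !tworld_imp.
by move=> /implyP H /H /implyP.
Qed.

Lemma tworld_KP a b : sval w (tBoxP (tImp a b)) -> sval w (tBoxP a) -> sval w (tBoxP b).
Proof.
have := tworld_S4t (ntl_KP S4t_normal a b); rewrite !tworld_imp.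
by move=> /implyP H /H /implyP.
Qed.

Lemma tworld_monoP a b : Y (tImp a b) -> sval w (tBoxP a) -> sval w (tBoxP b).
Proof. by move=> /(tt_necP Yt)/tworld_sub/tworld_KP. Qed.

Lemma tworld_diaP a : sval w (tDiaP a) = ~~ sval w (tBoxP (tNeg a)).
Proof.
have := tworld_S4t (ntl_dual S4t_normal a).
rewrite tworld_and !tworld_imp tworld_neg.
by case: (sval w (tDiaP a)); case: (sval w _).
Qed.

Lemma tworld_diaP_mono a b :
  Y (tImp a b) -> sval w (tDiaP a) -> sval w (tDiaP b).
Proof.
move=> Yab; rewrite !tworld_diaP; apply/contra/tworld_monoP.
by apply: tt_taut1 Yab => v /=; do 2!case: tval.
Qed.

Lemma tworld_diaP_disj D :
  sval w (tDiaP (tdisj D)) -> has (fun a => sval w (tDiaP a)) D.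
Proof.
elim: D => [|a D IH] /=.
  rewrite tworld_diaP tworld_sub //; apply: (tt_necP Yt).
  by apply: tt_taut.
move=> wD; apply/orP; case: (boolP (sval w (tDiaP a))); first by left.
rewrite tworld_diaP negbK => wa; right; apply: IH; move: wD.
rewrite !tworld_diaP; apply: contra => /(tworld_KP _); apply.
move: wa; apply: tworld_monoP; apply: tt_taut => v /=.
by do 2!case: tval.
Qed.

Lemma tworld_boxF_conj G a :
  Y (tImp (tconj G) a) -> all (fun b => sval w (tBoxF b)) G -> sval w (tBoxF a).
Proof.
elim: G a => [|b G IH] a /= Ya.
  by move=> _; apply/tworld_sub/(tt_necF Yt)/(tt_mp Yt _ Ya); apply: tt_taut.
move=> /andP[wb wG]; apply: tworld_KF wb; apply: IH wG.
by apply: tt_taut1 Ya => v /=; do 3!case: tval.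
Qed.

(** This is the axiom [ntl_convP] for [tNeg a], contraposed. *)
Lemma tworld_diaP_boxF a : sval w (tDiaP (tBoxF a)) -> sval w a.
Proof.
apply: contraTT; rewrite -tworld_neg tworld_diaP negbK => wna.
have := tworld_S4t (ntl_convP S4t_normal (tNeg a)); rewrite tworld_imp wna /=.
apply: tworld_monoP.
(* [tDiaF (tNeg a)] unfolds to the negation of [tBoxF (tNeg (tNeg a))], so a double negation has to
   be handled under the box. *)
have := tt_S4t Yt (ntl_KF S4t_normal a (tNeg (tNeg a))).
have : Y (tBoxF (tImp a (tNeg (tNeg a)))).
  by apply/(tt_necF Yt)/tt_taut => v /=; case: tval.
by apply: tt_taut2 => v /=; case: (v _); case: (v _); case: (v _).
Qed.

Lemma tworld_convF a : sval w a -> sval w (tBoxF (tDiaP a)).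
Proof.
by have := tworld_S4t (ntl_convF S4t_normal a); rewrite tworld_imp => /implyP.
Qed.

End World.

Lemma tworld_extend (G0 D0 : set tform) :
  (forall G D, (forall a, a \in G -> G0 a) -> (forall a, a \in D -> D0 a) ->
     ~ tentails G D) ->
  exists v : tworld, (forall a, G0 a -> sval v a) /\ (forall a, D0 a -> ~~ sval v a).
Proof.
by move=> /(scott_prime_ext tentails_scott)[v [vp vG vD]]; exists (exist _ v vp).
Qed.

(** A criterion for [tacc] in terms of the past diamond, used to build predecessors. *)
Lemma tacc_diaP (w v : tworld) :
  (forall a, sval w a -> sval v (tDiaP a)) -> tacc w v.
Proof. by move=> wv a wa; apply/tworld_diaP_boxF/wv. Qed.

Lemma canonical_tmodel : tmodel tacc (fun w a => sval w a).
Proof.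
split.
- move=> w a wa; have := tworld_S4t w (S4t_ax (S4t_TF a)).
  by rewrite tworld_imp wa.
- move=> v u w uv vw a ua; apply/vw/uv.
  by have := tworld_S4t u (S4t_ax (S4t_4F a)); rewrite tworld_imp ua.
- move=> w; apply/negbTE; rewrite -tworld_neg tworld_sub //.
  by apply: tt_taut.
- by move=> w; apply: tworld_sub; apply: tt_taut.
- exact: tworld_neg.
- exact: tworld_and.
- exact: tworld_or.
- move=> w a; split=> [wa v wv|wa]; first exact: wv.
  apply: contrapT => nwa.
  have [G D GG DD GD|v [vG vD]] := @tworld_extend
    [set b | sval w (tBoxF b)] [set a].
    apply: nwa; apply: (tworld_boxF_conj (G := G)); last exact/allP.
    apply: tt_taut1 GD => x; rewrite tval_entails /= tval_conj -implybE.
    move=> /implyP H; apply/implyP => /H /hasP[d /DD ->] //.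
  by have := vD a erefl; rewrite wa // => b /vG.
- move=> w a; split=> [wa|[v vw va]]; last first.
    by apply: vw; apply: tworld_convF.
  (* Avoiding every formula whose past diamond fails at [w] is what makes [v] a predecessor of
     [w]. *)
  have [G D GG DD GD|v [vG vD]] := @tworld_extend
    [set a] [set b | ~~ sval w (tDiaP b)].
    have YD : Y (tImp a (tdisj D)).
      apply: tt_taut1 GD => x; rewrite tval_entails /= -implybE tval_disj.
      move=> /implyP H; apply/implyP => xa; apply: H.
      by apply/allP => g /GG ->.
    have /hasP[d /DD /negP] := tworld_diaP_disj (tworld_diaP_mono YD wa).
    by [].
  exists v; last exact: vG.
  by apply: tacc_diaP => b; apply: contraTT => /vD.
Qed.

Lemma ttheory_complete a : (forall w : tworld, sval w a) -> Y a.
Proof.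
move=> Wa; apply: contrapT => nYa.
have [G D GG DD GD|v [_ vD]] := @tworld_extend set0 [set a].
  apply: nYa; apply: tt_taut1 GD => x; rewrite tval_entails.
  have -> : G = [::] by case: G GG => // g G /(_ g (mem_head _ _)).
  by move=> /hasP[d /DD ->].
by have := vD a erefl; rewrite Wa.
Qed.

End Canonical.

(** Membership in a theory becomes truth at all worlds of one model, so that later equivalences can
    be checked semantically. *)
Theorem ttheory_model Y : ttheory Y ->
  exists W (R : W -> W -> Prop) m, tmodel R m /\ forall a, Y a <-> forall w, m w a.
Proof.
move=> Yt; exists (tworld Y), (@tacc Y), (fun w => sval w).
split=> [|a]; first exact: canonical_tmodel.
by split=> [Ya w|]; [apply: tworld_sub|apply: ttheory_complete].
Qed.

(** * Kripke models of bi-intuitionistic theories *)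

Record bmodel (W : Type) (R : W -> W -> Prop) (m : W -> bform -> bool) : Prop := {
  bm_bot : forall w, m w bBot = false;
  bm_top : forall w, m w bTop = true;
  bm_and : forall w a b, m w (bAnd a b) = m w a && m w b;
  bm_or : forall w a b, m w (bOr a b) = m w a || m w b;
  bm_imp : forall w a b, m w (bImp a b) <-> forall v, R w v -> m v a -> m v b;
  bm_coimp : forall w a b,
    m w (bCoimp a b) <-> exists v, [/\ R v w, m v a & ~~ m v b] }.

Record btheory (X : set bform) : Prop := {
  bt_biIPC : biIPC `<=` X;
  bt_mp : forall a b, X a -> X (bImp a b) -> X b;
  bt_dn : forall a, X a -> X (bNeg (bCoimp bTop a)) }.

Lemma bsi_logic_theory X : bsi_logic X -> btheory X.
Proof. by case. Qed.

Section BiCanonical.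
Variable X : set bform.
Hypothesis Xt : btheory X.

Definition ble a b := X (bImp a b).

Lemma bt_ax a : biIPC a -> X a. Proof. exact: bt_biIPC. Qed.

Lemma ble_const a b : X b -> ble a b.
Proof. by move=> Xb; apply: (bt_mp Xt Xb); apply/bt_ax/biIPC_K. Qed.

Lemma ble_S a b c : ble a (bImp b c) -> ble a b -> ble a c.
Proof.
move=> abc ab; apply: (bt_mp Xt ab); apply: (bt_mp Xt abc).
exact/bt_ax/biIPC_S.
Qed.

Lemma ble_mp a b : X a -> ble a b -> X b. Proof. exact: bt_mp. Qed.

Lemma ble_trans b a c : ble a b -> ble b c -> ble a c.
Proof. by move=> ab bc; apply: ble_S ab; apply: ble_const. Qed.

Lemma ble_refl a : ble a a.
Proof. by apply: (@ble_S a (bImp a a)); apply/bt_ax/biIPC_K. Qed.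

Lemma ble_and c a b : ble c a -> ble c b -> ble c (bAnd a b).
Proof.
move=> ca cb; apply: ble_S cb; apply: ble_trans ca _; exact/bt_ax/biIPC_and.
Qed.

Lemma ble_andl a b : ble (bAnd a b) a. Proof. exact/bt_ax/biIPC_andl. Qed.
Lemma ble_andr a b : ble (bAnd a b) b. Proof. exact/bt_ax/biIPC_andr. Qed.
Lemma ble_orl a b : ble a (bOr a b). Proof. exact/bt_ax/biIPC_orl. Qed.
Lemma ble_orr a b : ble b (bOr a b). Proof. exact/bt_ax/biIPC_orr. Qed.

Lemma ble_or a b c : ble a c -> ble b c -> ble (bOr a b) c.
Proof.
move=> ac bc; apply: (bt_mp Xt bc); apply: (bt_mp Xt ac); exact/bt_ax/biIPC_or.
Qed.

Lemma ble_imp a b c : ble (bAnd a b) c <-> ble a (bImp b c).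
Proof.
split=> abc.
  have ab : ble a (bImp b (bAnd a b)) by apply/bt_ax/biIPC_and.
  apply: ble_trans ab _; apply: (@ble_mp (bImp b (bImp (bAnd a b) c))).
    exact: ble_const.
  exact/bt_ax/biIPC_S.
apply: (@ble_S _ b); last exact: ble_andr.
exact: ble_trans (ble_andl _ _) abc.
Qed.

(** From left to right: [(a <- b) <- c] lies below [a <- (b \/ c)], hence below
    [T <- (a -> (b \/ c))], which [bt_dn] refutes; then [biIPC_co4] applies. *)
Lemma ble_coimp a b c : ble a (bOr b c) <-> ble (bCoimp a b) c.
Proof.
split=> [abc|abc]; last first.
  apply: ble_trans (bt_ax (biIPC_co1 a b)) _.
  by apply: ble_or (ble_orl _ _) _; apply: ble_trans abc (ble_orr _ _).
apply: (bt_mp Xt _ (bt_ax (biIPC_co4 _ _))).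
apply: ble_trans (bt_ax (biIPC_co3 a b c)) _.
apply: ble_trans (bt_ax (biIPC_co2 _ _)) _.
exact: bt_dn.
Qed.

Definition bconj (G : seq bform) := foldr bAnd bTop G.
Definition bdisj (G : seq bform) := foldr bOr bBot G.

Lemma ble_conj G a : a \in G -> ble (bconj G) a.
Proof.
elim: G => //= b G IH; rewrite inE => /orP[/eqP->|/IH]; first exact: ble_andl.
exact/ble_trans/ble_andr.
Qed.

Lemma ble_conj_glb G c : (forall a, a \in G -> ble c a) -> ble c (bconj G).
Proof.
elim: G => /= [|b G IH] cG; first exact/ble_const/bt_ax/biIPC_top.
apply: ble_and; first exact/cG/mem_head.
by apply: IH => a aG; apply: cG; rewrite inE aG orbT.
Qed.

Lemma ble_disj G a : a \in G -> ble a (bdisj G).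
Proof.
elim: G => //= b G IH; rewrite inE => /orP[/eqP->|/IH]; first exact: ble_orl.
by move=> aG; apply: ble_trans aG (ble_orr _ _).
Qed.

Lemma ble_disj_lub G c : (forall a, a \in G -> ble a c) -> ble (bdisj G) c.
Proof.
elim: G => /= [|b G IH] cG; first exact/bt_ax/biIPC_bot.
apply: ble_or; first exact/cG/mem_head.
by apply: IH => a aG; apply: cG; rewrite inE aG orbT.
Qed.

Definition bentails (G D : seq bform) : Prop := ble (bconj G) (bdisj D).

Lemma bentails_scott : scott bentails.
Proof.
split=> [a|G G' D D' GG DD GD|G D a]; rewrite /bentails /=.
- exact: ble_trans (ble_andl _ _) (ble_orl _ _).
- apply: (ble_trans (b := bconj G)).
    by apply: ble_conj_glb => a /GG/ble_conj.
  by apply: ble_trans GD _; apply: ble_disj_lub => a /DD/ble_disj.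
- move=> H1 H2.
  apply: (ble_S _ H1).
  apply/ble_imp; rewrite -/ble.
  (* Residuation supplies the distributivity that cut needs. *)
  have H3 : ble (bOr a (bdisj D)) (bImp (bconj G) (bdisj D)).
    by apply: ble_or; [exact/ble_imp|exact/bt_ax/biIPC_K].
  apply: (@ble_S _ (bconj G)); last exact: ble_andl.
  exact: ble_trans (ble_andr _ _) H3.
Qed.

Definition bworld : Type := {w : bform -> bool | prime_set bentails w}.

Definition bacc (w v : bworld) : Prop := forall a, sval w a -> sval v a.

Section World.
Variable w : bworld.

Lemma bworld_le a b : ble a b -> sval w a -> sval w b.
Proof.
move=> ab wa; have := svalP w [:: a] [:: b]; rewrite /= orbF andbT; apply=> //.
exact: ble_trans (ble_andl _ _) (ble_trans ab (ble_orl _ _)).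
Qed.

Lemma bworld_sub a : X a -> sval w a.
Proof.
move=> Xa; have := svalP w [::] [:: a]; rewrite /= orbF; apply=> //.
exact/ble_const/(ble_mp Xa)/ble_orl.
Qed.

Lemma bworld_bot : sval w bBot = false.
Proof.
apply/negP => w0; have := svalP w [:: bBot] [::]; rewrite /= w0 => H.
by suff : false by []; apply: H => //; apply: ble_andl.
Qed.

Lemma bworld_and a b : sval w (bAnd a b) = sval w a && sval w b.
Proof.
apply/idP/andP => [wab|[wa wb]].
  by split; apply: bworld_le wab; [exact: ble_andl|exact: ble_andr].
have := svalP w [:: a; b] [:: bAnd a b]; rewrite /= wa wb orbF; apply=> //.
apply: ble_trans (ble_orl _ _); apply: ble_and; first exact: ble_andl.
exact: ble_trans (ble_andr _ _) (ble_andl _ _).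
Qed.

Lemma bworld_or a b : sval w (bOr a b) = sval w a || sval w b.
Proof.
apply/idP/orP => [wab|[]]; last 2 first.
- exact/bworld_le/ble_orl.
- exact/bworld_le/ble_orr.
have := svalP w [:: bOr a b] [:: a; b]; rewrite /= wab orbF.
move=> H; apply/orP; apply: H => //.
apply: ble_trans (ble_andl _ _) _; apply: ble_or; first exact: ble_orl.
exact: ble_trans (ble_orl _ _) (ble_orr _ _).
Qed.

Lemma bworld_conj G : sval w (bconj G) = all (sval w) G.
Proof.
elim: G => /= [|a G <-]; last exact: bworld_and.
exact/bworld_sub/bt_ax/biIPC_top.
Qed.

Lemma bworld_disj G : sval w (bdisj G) = has (sval w) G.
Proof.
elim: G => /= [|a G <-]; [exact: bworld_bot | exact: bworld_or].
Qed.

End World.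

Lemma bworld_extend (G0 D0 : set bform) :
  (forall G D, (forall a, a \in G -> G0 a) -> (forall a, a \in D -> D0 a) ->
     ~ bentails G D) ->
  exists v : bworld, (forall a, G0 a -> sval v a) /\ (forall a, D0 a -> ~~ sval v a).
Proof.
by move=> /(scott_prime_ext bentails_scott)[v [vp vG vD]]; exists (exist _ v vp).
Qed.

Lemma canonical_bmodel : bmodel bacc (fun w a => sval w a).
Proof.
split.
- exact: bworld_bot.
- by move=> w; apply/bworld_sub/bt_ax/biIPC_top.
- exact: bworld_and.
- exact: bworld_or.
- move=> w a b; split=> [wab v /(_ _ wab) vab va|wab].
    have : sval v (bAnd (bImp a b) a) by rewrite bworld_and vab va.
    by apply: bworld_le; apply/ble_imp/ble_refl.
  apply: contrapT => nw.
  (* The successor must contain [w] and [a] and omit [b]. If that were inconsistent, the part of [G]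
     lying in [w] would entail [bImp a b]. *)
  have [G D GG DD GD|v [vG vD]] := @bworld_extend
    [set c | sval w c \/ c = a] [set b].
    apply: nw; apply: (@bworld_le w (bconj [seq c <- G | sval w c])).
      apply/ble_imp; apply: (ble_trans (b := bconj G)).
        apply: ble_conj_glb => c cG; case: (boolP (sval w c)) => [wc|nwc].
          apply: ble_trans (ble_andl _ _) _; apply: ble_conj.
          by rewrite mem_filter wc.
        by case: (GG c cG) nwc => [->//|-> _]; apply: ble_andr.
      apply: ble_trans GD _; apply: ble_disj_lub => d /DD ->; exact: ble_refl.
    by rewrite bworld_conj; apply/allP => c; rewrite mem_filter => /andP[].
  have := vD b erefl; rewrite wab //; last by apply: vG; right.
  by move=> c wc; apply: vG; left.
- move=> w a b; split=> [wab|[v [vw va nvb]]]; last first.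
    apply: vw; have := bworld_le (proj2 (ble_coimp a b _) (ble_refl _)) va.
    by rewrite bworld_or (negbTE nvb).
  (* A predecessor has to be included in [w], so everything outside [w] is excluded together with
     [b]. *)
  have [G D GG DD GD|v [vG vD]] := @bworld_extend
    [set a] [set c | ~~ sval w c \/ c = b].
    suff H : ble (bCoimp a b) (bdisj [seq c <- D | ~~ sval w c]).
      move: (bworld_le H wab); rewrite bworld_disj => /hasP[d].
      by rewrite mem_filter => /andP[/negbTE ->].
    apply/ble_coimp; apply: (ble_trans (b := bconj G)).
      by apply: ble_conj_glb => c /GG ->; apply: ble_refl.
    apply: ble_trans GD _; apply: ble_disj_lub => c cD.
    case: (boolP (sval w c)) => [wc|nwc].
      by case: (DD c cD) => [|->]; [rewrite wc|exact: ble_orl].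
    apply: ble_trans (ble_orr _ _); apply: ble_disj.
    by rewrite mem_filter nwc.
  exists v; split.
  - by move=> c; apply: contraTT => nc; apply: vD; left.
  - exact: vG.
  - by apply: vD; right.
Qed.

Lemma btheory_complete a : (forall w : bworld, sval w a) -> X a.
Proof.
move=> Wa; apply: contrapT => nXa.
have [G D GG DD GD|v [_ vD]] := @bworld_extend set0 [set a].
  have G0 : G = [::] by case: G GG {GD} => // g G /(_ g (mem_head _ _)).
  apply: nXa; apply: (@ble_mp (bconj G)).
    by rewrite G0; apply/bt_ax/biIPC_top.
  apply: ble_trans GD _; apply: ble_disj_lub => d /DD ->; exact: ble_refl.
by have := vD a erefl; rewrite Wa.
Qed.

End BiCanonical.

Theorem btheory_model X : btheory X ->
  exists W (R : W -> W -> Prop) (m : W -> bform -> bool),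
    [/\ forall w, R w w, forall v u w, R u v -> R v w -> R u w,
        forall w v a, R w v -> m w a -> m v a, bmodel R m
        & forall a, X a <-> forall w, m w a].
Proof.
move=> Xt; exists (bworld X), (@bacc X), (fun w => sval w); split.
- by move=> w a.
- by move=> v u w uv vw a /uv/vw.
- by move=> w v a; apply.
- exact: canonical_bmodel.
- by move=> a; split=> [Xa w|]; [apply: bworld_sub|apply: btheory_complete].
Qed.

(** * Tense formulae over Boolean combinations of upsets *)

(* A list [c] stands for the conjunction of the Boolean implications
   [x.1 -> x.2], [x] in [c]; every Boolean combination of bi-intuitionistic
   truth sets has this form. *)
Definition cnf : Type := seq (bform * bform).

(** Classically, [(x1 -> x2) \/ (y1 -> y2)] is [(x1 /\ y1) -> (x2 \/ y2)]. *)
Definition cnf_or (c d : cnf) : cnf :=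
  [seq (bAnd x.1 y.1, bOr x.2 y.2) | x <- c, y <- d].

(** The negation of [x1 -> x2] is the conjunction of [T -> x1] and [x2 -> bot]. *)
Definition cnf_neg (c : cnf) : cnf :=
  foldr (fun x d => cnf_or [:: (bTop, x.1); (x.2, bBot)] d) [:: (bTop, bBot)] c.

(** The box of a Boolean implication between truth sets is their bi-intuitionistic implication. *)
Definition cnf_box (c : cnf) : bform :=
  foldr (fun x a => bAnd (bImp x.1 x.2) a) bTop c.

(* The diamond of the negation of [c]. *)
Definition cnf_dian (c : cnf) : bform :=
  foldr (fun x a => bOr (bCoimp x.1 x.2) a) bBot c.

(** Shows that these Boolean combinations are closed under the tense modalities. Since [cnf_dian]
    negates its argument, the last clause negates beforehand. *)
Fixpoint cnf_of (e : nat -> cnf) (a : tform) : cnf :=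
  match a with
  | tVar n => e n
  | tBot => [:: (bTop, bBot)]
  | tTop => [::]
  | tNeg a => cnf_neg (cnf_of e a)
  | tAnd a b => cnf_of e a ++ cnf_of e b
  | tOr a b => cnf_or (cnf_of e a) (cnf_of e b)
  | tBoxF a => [:: (bTop, cnf_box (cnf_of e a))]
  | tDiaP a => [:: (bTop, cnf_dian (cnf_neg (cnf_of e a)))]
  end.

Section Cnf.
Variables (W : Type) (R : W -> W -> Prop) (mem : W -> bform -> bool).
Hypothesis bR : bmodel R mem.

Definition cnf_val (w : W) (c : cnf) : bool :=
  all (fun x => mem w x.1 ==> mem w x.2) c.

Arguments cnf_val : simpl never.

Lemma cnf_val_top w a : cnf_val w [:: (bTop, a)] = mem w a.
Proof. by rewrite /cnf_val /= (bm_top bR) andbT. Qed.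

Lemma cnf_val_or w c d : cnf_val w (cnf_or c d) = cnf_val w c || cnf_val w d.
Proof.
elim: c => //= x c IH; rewrite /cnf_val /cnf_or /= all_cat.
rewrite -/(cnf_or c d) -/(cnf_val w (cnf_or c d)) IH orb_andl; congr andb.
elim: d {IH} => [|y d IH] /=; first by rewrite orbT.
rewrite IH (bm_and bR) (bm_or bR) /cnf_val /=.
by case: (mem w x.1) (mem w x.2) (mem w y.1) (mem w y.2) => [] [] [] [].
Qed.

Lemma cnf_val_neg w c : cnf_val w (cnf_neg c) = ~~ cnf_val w c.
Proof.
elim: c => [|x c IH] /=; first by rewrite cnf_val_top (bm_bot bR).
rewrite cnf_val_or IH /cnf_val /= (bm_top bR) (bm_bot bR) negb_and.
by case: (mem w x.1) (mem w x.2) => [] [].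
Qed.

Lemma cnf_box_val w c : mem w (cnf_box c) <-> forall v, R w v -> cnf_val v c.
Proof.
elim: c => [|x c IH] /=; first by rewrite (bm_top bR).
rewrite (bm_and bR); split=> [/andP[/(bm_imp bR) wx /IH wc] v wv|wc].
  by apply/andP; split; [apply/implyP/wx|apply: wc].
apply/andP; split; first by apply/(bm_imp bR) => v /wc /andP[/implyP].
by apply/IH => v /wc /andP[].
Qed.

Lemma cnf_dian_val w c :
  mem w (cnf_dian c) <-> exists2 v, R v w & ~~ cnf_val v c.
Proof.
elim: c => [|x c IH] /=; first by rewrite (bm_bot bR); split=> // -[].
rewrite (bm_or bR); split=> [/orP[/(bm_coimp bR)[v [vw vx nvx]]|/IH[v vw nv]]|].
- by exists v => //; rewrite negb_and vx (negbTE nvx).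
- by exists v => //; rewrite negb_and orbC nv.
move=> [v vw]; rewrite negb_and negb_imply => /orP[/andP[vx nvx]|nv]; apply/orP.
  by left; apply/(bm_coimp bR); exists v.
by right; apply/IH; exists v.
Qed.

Lemma cnf_of_val m e : tmodel R m ->
  (forall w n, m w (tVar n) = cnf_val w (e n)) ->
  forall a w, m w a = cnf_val w (cnf_of e a).
Proof.
move=> mR mv; elim=> [n|||a IH|a IHa b IHb|a IHa b IHb|a IH|a IH] w /=.
- exact: mv.
- by rewrite cnf_val_top (bm_bot bR) (tm_bot mR).
- exact: tm_top mR w.
- by rewrite (tm_neg mR) cnf_val_neg IH.
- by rewrite (tm_and mR) /cnf_val all_cat IHa IHb.
- by rewrite (tm_or mR) cnf_val_or IHa IHb.
- rewrite cnf_val_top; apply/idP/idP.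
    move=> /(tm_boxF mR) wa; apply/cnf_box_val => v /wa; by rewrite IH.
  by move=> /cnf_box_val wa; apply/(tm_boxF mR) => v /wa; rewrite IH.
- rewrite cnf_val_top; apply/idP/idP.
    move=> /(tm_diaP mR)[v vw va]; apply/cnf_dian_val; exists v => //.
    by rewrite cnf_val_neg negbK -IH.
  move=> /cnf_dian_val[v vw]; rewrite cnf_val_neg negbK -IH => va.
  by apply/(tm_diaP mR); exists v.
Qed.

End Cnf.

(** * Boxed atoms *)

Definition box_vars : tform -> tform := tsubst (fun n => tBoxF (tVar n)).

(** An inverse of [T] on formulae with boxed variables: in every [tmodel] its translation is
    equivalent to [tBoxF (box_vars a)]. *)
Definition bform_of (a : tform) : bform :=
  cnf_box (cnf_of (fun n => [:: (bTop, bVar n)]) a).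

Section BoxVars.
Variables (W : Type) (R : W -> W -> Prop) (m : W -> tform -> bool).
Hypothesis mR : tmodel R m.

(** Translations obey the bi-intuitionistic clauses inside a tense model, so normal forms can be
    evaluated on them. *)
Lemma T_bmodel : bmodel R (fun w a => m w (T a)).
Proof.
split=> [w|w|w a b|w a b|w a b|w a b] /=.
- exact: tm_bot mR w.
- exact: tm_top mR w.
- exact: tm_and mR w _ _.
- exact: tm_or mR w _ _.
- split=> [/(tm_boxF mR) wab v /wab|wab].
    by rewrite (tm_or mR) (tm_neg mR) -implybE => /implyP.
  apply/(tm_boxF mR) => v /wab; rewrite (tm_or mR) (tm_neg mR) -implybE => H.
  exact/implyP.
- split=> [/(tm_diaP mR)[v vw]|[v [vw va vb]]].
    by rewrite (tm_and mR) (tm_neg mR) => /andP[]; exists v.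
  by apply/(tm_diaP mR); exists v => //; rewrite (tm_and mR) (tm_neg mR) va.
Qed.

Lemma T_bform_of w a : m w (T (bform_of a)) = m w (tBoxF (box_vars a)).
Proof.
have E v b : m v (box_vars b) = _ :=
  cnf_of_val T_bmodel (e := fun n => [:: (bTop, bVar n)])
    (tmodel_subst (fun n => tBoxF (tVar n)) mR)
    (fun v n => esym (cnf_val_top T_bmodel v (bVar n))) b v.
apply/idP/idP => [/(cnf_box_val T_bmodel) wa|/(tm_boxF mR) wa].
  by apply/(tm_boxF mR) => v /wa; rewrite -E.
by apply/(cnf_box_val T_bmodel) => v /wa; rewrite -E.
Qed.

Lemma T_bform_of_global a :
  (forall w, m w (T (bform_of a))) <-> forall w, m w (box_vars a).
Proof.
split=> wa w; last by rewrite T_bform_of; apply/(tm_boxF mR).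
have := wa w; rewrite T_bform_of => /(tm_boxF mR); apply; exact: tm_refl mR w.
Qed.

End BoxVars.

(** * The greatest companion is conservative *)

Fixpoint kval W (R : W -> W -> Prop) (v : W -> nat -> bool) (w : W) (a : tform) :=
  match a with
  | tVar n => v w n
  | tBot => false
  | tTop => true
  | tNeg a => ~~ kval R v w a
  | tAnd a b => kval R v w a && kval R v w b
  | tOr a b => kval R v w a || kval R v w b
  | tBoxF a => `[< forall u, R w u -> kval R v u a >]
  | tDiaP a => `[< exists2 u, R u w & kval R v u a >]
  end.

Lemma bsubst_id a : bsubst bVar a = a.
Proof. by elim: a => //= a -> b ->. Qed.

Lemma kval_tmodel W (R : W -> W -> Prop) v :
  (forall w, R w w) -> (forall v u w, R u v -> R v w -> R u w) ->
  tmodel R (kval R v).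
Proof. by move=> Rr Rt; split=> //= w a; split=> /asboolP. Qed.

Section BiFrame.
Variables (W : Type) (R : W -> W -> Prop) (mem : W -> bform -> bool).
Hypothesis Rrefl : forall w, R w w.
Hypothesis Rtrans : forall v u w, R u v -> R v w -> R u w.
Hypothesis mem_mono : forall w v a, R w v -> mem w a -> mem v a.
Hypothesis bR : bmodel R mem.

Local Notation cnf_val := (cnf_val mem).

(** Models on the general frame whose admissible sets are the Boolean combinations of truth sets of
    [mem]. *)
Definition admissible (m : W -> tform -> bool) : Prop :=
  tmodel R m /\ forall n, exists c, forall w, m w (tVar n) = cnf_val w c.

Lemma admissibleP m : admissible m ->
  tmodel R m /\ forall a, exists c, forall w, m w a = cnf_val w c.
Proof.
case=> mR /(@choice nat cnf)[e me]; split=> // a.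
by exists (cnf_of e a) => w; apply: (cnf_of_val bR mR).
Qed.

Lemma admissible_subst m s : admissible m -> admissible (fun w a => m w (tsubst s a)).
Proof.
by move=> /admissibleP[mR me]; split; [exact: tmodel_subst|move=> n; exact: me].
Qed.

Definition cnf_atoms (c : cnf) : seq bform := flatten [seq [:: x.1; x.2] | x <- c].

(* A cnf can change value along R only when one of its finitely many upsets
   is entered, which is why the Grzegorczyk axioms hold. *)
Lemma cnf_val_change w v c : R w v -> cnf_val w c != cnf_val v c ->
  count (mem w) (cnf_atoms c) < count (mem v) (cnf_atoms c).
Proof.
move=> wv; apply: contraR; rewrite -leqNgt => le; apply/eqP.
have : {in cnf_atoms c, forall a, mem w a = mem v a}.
  elim: (cnf_atoms c) le => //= b s IH le a.
  have leb : mem w b <= mem v b by case: (mem w b) (@mem_mono w v b wv) => [->|].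
  have les : count (mem w) s <= count (mem v) s by apply: sub_count => x; apply: mem_mono.
  have Eb : mem w b = mem v b.
    by case: (mem w b) (mem v b) leb le => [] [] // _; rewrite add0n add1n ltnNge les.
  rewrite inE => /orP[/eqP-> //|]; apply: IH.
  by move: le; rewrite Eb leq_add2l.
elim: c {le} => //= x c IH E; rewrite /cnf_val /= -!/(cnf_val _ c) IH.
  by rewrite !E // !inE eqxx ?orbT.
by move=> a ac; apply: E; rewrite !inE ac !orbT.
Qed.

Lemma T_mem m s : tmodel R m ->
  (forall n w, m w (tBoxF (tVar n)) = mem w (s n)) ->
  forall a w, m w (T a) = mem w (bsubst s a).
Proof.
move=> mR ms; elim=> [n|||a IHa b IHb|a IHa b IHb|a IHa b IHb|a IHa b IHb] w /=.
- exact: ms.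
- by rewrite (tm_bot mR) (bm_bot bR).
- by rewrite (tm_top mR) (bm_top bR).
- by rewrite (tm_and mR) (bm_and bR) IHa IHb.
- by rewrite (tm_or mR) (bm_or bR) IHa IHb.
- apply/idP/idP => [/(bm_imp (T_bmodel mR)) wab|/(bm_imp bR) wab].
    by apply/(bm_imp bR) => v /wab; rewrite IHa IHb.
  by apply/(bm_imp (T_bmodel mR) w a b) => v /wab; rewrite IHa IHb.
- apply/idP/idP => [/(bm_coimp (T_bmodel mR))[v []]|/(bm_coimp bR)[v []]].
    by rewrite IHa IHb => *; apply/(bm_coimp bR); exists v.
  by rewrite -IHa -IHb => *; apply/(bm_coimp (T_bmodel mR) w a b); exists v.
Qed.

(** A boxed variable defines the truth set of some bi-formula, so translations are evaluated as
    substitution instances. Closure of the bsi system under substitution then makes them valid. *)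
Lemma admissible_T m : admissible m ->
  exists s, forall a w, m w (T a) = mem w (bsubst s a).
Proof.
case=> mR /(@choice nat cnf)[e me].
exists (fun n => cnf_box (e n)); apply: T_mem => // n w.
by apply/idP/idP => [/(tm_boxF mR) wn|/(cnf_box_val bR) wn];
  [apply/(cnf_box_val bR)|apply/(tm_boxF mR)] => v /wn; rewrite me.
Qed.

Definition lvalid : set tform := [set a | forall m, admissible m -> forall w, m w a].

Definition rvalid : set (rule tform) :=
  [set r | forall m, admissible m -> (forall a, a \in r.1 -> forall w, m w a) ->
     exists2 d, d \in r.2 & forall w, m w d].

Lemma lvalid_tense_logic : tense_logic lvalid.
Proof.
split.
- by move=> s a va m /(admissible_subst s)/va.
- by move=> a /S4t_sound va m [mR _]; exact: va mR.
- by move=> a b va vab m ma w; have := vab m ma w; rewrite (tm_imp ma.1) va.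
- by move=> a va m ma w; apply/(tm_boxF ma.1) => v _; apply: va.
- by move=> a va m ma w; apply/(tm_boxP ma.1) => v _; apply: va.
Qed.

Lemma lvalid_GRZ_F : lvalid GRZ_F.
Proof.
move=> m ma w; have [mR /(_ 0)[c cE]] := ma; rewrite (tm_imp mR); apply/implyP.
(* [f u] counts the atoms of [c] that are false at [u]; induction on it takes the place of converse
   well-foundedness of [R]. *)
pose f u := size (cnf_atoms c) - count (mem u) (cnf_atoms c).
elim: {w}(f w).+1 {-2}w (ltnSn (f w)) => // k IH w; rewrite ltnS => wk box.
apply: contraT => nw; have := proj1 (tm_boxF mR w _) box w (Rrefl w).
rewrite (tm_imp mR) (negbTE nw) implybF => /negP; case; apply/(tm_boxF mR) => v wv.
rewrite (tm_imp mR); apply/implyP => pv; apply/(tm_boxF mR) => u vu.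
apply: contraT => nu; have wu := Rtrans wv vu; rewrite -(negbTE nu).
apply: IH; last first.
  by apply/(tm_boxF mR) => t /(Rtrans wu); apply: (proj1 (tm_boxF mR w _) box).
apply: leq_trans wk; have := count_size (mem u) (cnf_atoms c).
(* The variable fails at [w], holds at [v] and fails at [u], so each of the two steps enters a new
   upset. *)
have := cnf_val_change wv; have := cnf_val_change vu.
move=> /(_ c); rewrite -!cE (negbTE nu) pv => /(_ isT) vu'.
move=> /(_ c); rewrite -!cE (negbTE nw) pv => /(_ isT) wv' le.
by rewrite /f ltn_sub2l ?(leq_trans _ le) ?(ltn_trans wv').
Qed.

Lemma lvalid_GRZ_P : lvalid GRZ_P.
Proof.
move=> m ma w; have [mR /(_ 0)[c cE]] := ma; rewrite (tm_imp mR); apply/implyP.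
(* This measure drops on passing from [w] down to the point [t] found below, since the variable
   fails at the intermediate [v]. *)
pose f u := count (mem u) (cnf_atoms c).
elim: {w}(f w).+1 {-2}w (ltnSn (f w)) => // k IH w; rewrite ltnS => wk pw.
apply: contraT => nw.
pose q := tDiaP (tAnd (tDiaP (tVar 0)) (tNeg (tVar 0))).
have [u uw /(tm_diaP mR)] : exists2 u, R u w & m u q.
  apply: contrapT => no; move/negP: nw; apply; apply/(tm_diaP mR); exists w => //.
  by rewrite (tm_and mR) pw (tm_neg mR); apply/negP => H; apply: no; exists w.
case=> v vu; rewrite (tm_and mR) (tm_neg mR) => /andP[/(tm_diaP mR)[t tv pt] nv].
have vw := Rtrans vu uw.
suff /(tm_diaP mR)[z zt pz] : m t (tDiaP (tAnd (tVar 0) (tNeg q))).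
  rewrite -(negbTE nw); apply/(tm_diaP mR); exists z => //.
  exact: Rtrans zt (Rtrans tv vw).
apply: (IH t _ pt); apply: leq_trans wk.
have := cnf_val_change tv; have := cnf_val_change vw.
move=> /(_ c); rewrite -!cE (negbTE nv) pw => /(_ isT) vw'.
move=> /(_ c); rewrite -!cE (negbTE nv) pt => /(_ isT) tv'.
exact: ltn_trans tv' vw'.
Qed.

Lemma lvalid_GRZT : GRZT `<=` lvalid.
Proof.
apply: smallest_sub; first exact: lvalid_tense_logic.
move=> a [|->]; last exact: lvalid_GRZ_P.
apply: smallest_sub; first exact: lvalid_tense_logic.
move=> {}a [|->]; last exact: lvalid_GRZ_F.
exact: tl_S4t lvalid_tense_logic _.
Qed.

Lemma lvalid_T (X : set bform) : (forall s a, X a -> X (bsubst s a)) ->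
  (forall a, X a -> forall w, mem w a) -> T @` X `<=` lvalid.
Proof.
move=> Xs Xv _ [a Xa <-] m ma w.
have [s sE] := admissible_T ma.
by rewrite sE; apply/Xv/Xs.
Qed.

Lemma rvalid_tense_rule_system : tense_rule_system rvalid.
Proof.
split; first split.
- move=> s [G D] r m ma /= mG.
  have [d dD md] : exists2 d, d \in D & forall w, m w (tsubst s d).
    apply: (r _ (admissible_subst s ma)) => a aG; apply: mG.
    by apply/imfsetP; exists a.
  by exists (tsubst s d) => //; apply/imfsetP; exists d.
- by move=> a m ma /= H; exists a; [rewrite inE|apply: H; rewrite inE].
- move=> G G' D D' r m ma /= mG; have [|d dD md] := r m ma.
    by move=> a aG; apply: mG; rewrite inE aG.
  by exists d; rewrite // inE dD.
- move=> G D a r1 r2 m ma /= mG; have [//|d] := r1 m ma.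
  rewrite !inE => /orP[dD|/eqP->] md; first by exists d.
  by apply: (r2 m ma) => b; rewrite !inE => /orP[/mG|/eqP->].
- move=> a Sa m ma _; exists a; first by rewrite inE.
  by move=> w; apply: (S4t_sound Sa) ma.1 w.
- move=> a b m ma H; exists b; first by rewrite inE.
  move=> w; have := H (tImp a b); rewrite !inE eqxx orbT => /(_ isT w).
  by rewrite (tm_imp ma.1) H // !inE eqxx.
- move=> a m ma H; exists (tBoxF a); first by rewrite inE.
  by move=> w; apply/(tm_boxF ma.1) => v _; apply: H; rewrite inE.
- move=> a m ma H; exists (tBoxP a); first by rewrite inE.
  by move=> w; apply/(tm_boxP ma.1) => v _; apply: H; rewrite inE.
Qed.

Lemma rvalid_axiom a : lvalid a -> rvalid (axiom_rule a).
Proof. by move=> va m ma _; exists a; [rewrite inE|exact: va]. Qed.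

Lemma rvalid_T (L : set (rule bform)) :
  (forall s r, L r -> L (map_rule (bsubst s) r)) ->
  (forall r, L r -> (forall a, a \in r.1 -> forall w, mem w a) ->
     exists2 d, d \in r.2 & forall w, mem w d) ->
  map_rule T @` L `<=` rvalid.
Proof.
move=> Ls Lv _ [[G D] LGD <-] m ma /= mG.
have [s sE] := admissible_T ma.
have /Lv /= := Ls s _ LGD; case=> [_ /imfsetP[a aG ->] w|_ /imfsetP[d dD ->] md].
  by rewrite -sE; apply: mG; apply/imfsetP; exists a.
exists (T d); first by apply/imfsetP; exists d.
by move=> w; rewrite sE.
Qed.

(** Each variable denotes its own truth set, which is an upset and so is unchanged by the box. *)
Lemma canonical_admissible : exists2 m, admissible m & forall a w, m w (T a) = mem w a.
Proof.
exists (kval R (fun w n => mem w (bVar n))).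
  split; first exact: kval_tmodel.
  by move=> n; exists [:: (bTop, bVar n)] => w; rewrite (cnf_val_top bR).
move=> a w; rewrite -{2}[a]bsubst_id.
apply: T_mem; first exact: kval_tmodel.
move=> {a w} n w; apply/asboolP/idP => [/(_ w (Rrefl w)) //|wn v wv].
exact: mem_mono wv wn.
Qed.

End BiFrame.

Theorem sigma_logic_conservative L a :
  bsi_logic L -> sigma_logic L (T a) -> L a.
Proof.
move=> Ll; have [W [R [mem [Rr Rt mm bR LE]]]] := btheory_model (bsi_logic_theory Ll).
have /(_ (T a)) H : sigma_logic L `<=` lvalid R mem.
  apply: smallest_sub; first exact: lvalid_tense_logic.
  move=> b [|]; first exact: lvalid_GRZT.
  apply: lvalid_T => //; first exact: bsi_subst.
  by move=> c /LE.
have [m ma mE] := canonical_admissible Rr Rt mm bR.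
by move=> /H sa; apply/LE => w; rewrite -mE; exact: sa.
Qed.

Lemma bsi_rule_system_ext L (r : rule bform) : bsi_rule_system L -> ~ L r ->
  exists X : set bform, [/\ btheory X, forall a, a \in r.1 -> X a,
    forall a, a \in r.2 -> ~ X a
    & forall q, L q -> (forall a, a \in q.1 -> X a) -> exists2 d, d \in q.2 & X d].
Proof.
move=> Ll /(rule_system_ext (bsi_rs Ll))[X [XG XD XL]].
exists X; split=> //; last by move=> a /XD/negP.
split.
- by move=> a /(bsi_rs_biIPC Ll)/XL[|d]; rewrite /= ?inE // => /eqP ->.
- move=> a b Xa Xab; have [|d] := XL _ (bsi_rs_mp Ll a b); rewrite /= ?inE //.
    by move=> c; rewrite !inE => /orP[]/eqP->.
  by move=> /eqP->.
- move=> a Xa; have [|d] := XL _ (bsi_rs_dn Ll a); rewrite /= ?inE //.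
    by move=> c; rewrite !inE => /eqP->.
  by move=> /eqP->.
Qed.

(** A saturated theory [X] refuting [r] has a model whose globally true formulae are exactly [X].
    The general frame over it validates all of [sigma_rs L] but refutes the translation of [r]. *)
Theorem sigma_rs_conservative L r :
  bsi_rule_system L -> sigma_rs L (map_rule T r) -> L r.
Proof.
move=> Ll sr; apply: contrapT => /(bsi_rule_system_ext Ll)[X [Xt XG XD XL]].
have [W [R [mem [Rr Rt mm bR XE]]]] := btheory_model Xt.
have : rvalid R mem (map_rule T r).
  move: sr; apply: smallest_sub; first exact: rvalid_tense_rule_system.
  have vS (Z : set tform) : Z `<=` GRZT -> rs_of_logic Z `<=` rvalid R mem.
    move=> ZG; apply: smallest_sub; first exact: rvalid_tense_rule_system.
    by move=> _ [a /ZG/(lvalid_GRZT Rr Rt mm bR) va <-]; apply: rvalid_axiom.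
  move=> q [|]; first exact: vS.
  apply: smallest_sub; first exact: rvalid_tense_rule_system.
  move=> {}q [|].
    by apply: vS => a Sa Y [Yl _]; apply: tl_S4t.
  apply: rvalid_T => //; first exact: rs_subst (bsi_rs Ll).
  move=> {}q Lq qX; have [a /qX qa|d dD Xd] := XL q Lq; first exact/XE.
  by exists d => //; apply/XE.
have [m ma mE] := canonical_admissible Rr Rt mm bR.
move=> /(_ m ma)[_ /imfsetP[a aG ->] w|_ /imfsetP[d dD ->] md].
  by rewrite mE; move: w; apply/XE/XG.
by apply: (XD d dD); apply/XE => w; rewrite -mE.
Qed.

(** * Eliminating naked variables over Grzegorczyk models *)

Fixpoint bits (n : nat) : seq bitseq :=
  if n is n'.+1 then [seq b :: s | b <- [:: true; false], s <- bits n'] else [:: [::]].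

Lemma mem_bits (s : bitseq) n : (s \in bits n) = (size s == n).
Proof.
elim: n s => [|n IH] [|b s] //=;
  first by rewrite cats0 mem_cat; apply/negP => /orP[] /mapP[].
rewrite eqSS -IH cats0 mem_cat; case: b; rewrite mem_map => [//|u v []//].
- by rewrite orbC; case: mapP => [[]|].
- by case: mapP => [[]|].
Qed.

Lemma count_lt (T : eqType) (p q : pred T) (x : T) s :
  subpred p q -> x \in s -> q x -> ~~ p x -> count p s < count q s.
Proof.
move=> pq xs qx npx.
have -> : count q s = count p s + count (predD q p) s.
  rewrite -count_predUI (@eq_count _ (predI _ _) pred0) ?count_pred0 ?addn0.
    by apply: eq_count => y /=; case: (boolP (p y)) => // /pq ->.
  by move=> y /=; case: (p y).
by rewrite -addn1 leq_add2l -has_count; apply/hasP; exists x; rewrite //= npx.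
Qed.

(** Above [z], the formula [a] is never regained once lost. [GRZ_F] gives this for [R], and [GRZ_P]
    gives it for the converse of [R]. *)
Definition grz_on W (R : W -> W -> Prop) (m : W -> tform -> bool) : Prop :=
  forall a w, m w a -> exists z, [/\ R w z, m z a
    & forall y, R z y -> (exists2 t, R y t & m t a) -> m y a].

(** * Existence of stable points *)

Section Peaks.
Variables (W : Type) (R : W -> W -> Prop) (m : W -> tform -> bool).
Hypothesis Rrefl : forall w, R w w.
Hypothesis Rtrans : forall v u w, R u v -> R v w -> R u w.
Hypothesis mgrz : grz_on R m.
Variables (P Q : seq tform).
Variable chi : bitseq -> bitseq -> tform.
Local Notation A w := (map (m w) P).
Local Notation B w := (map (m w) Q).
Hypothesis chiP : forall u w, m w (chi (A u) (B u)) = (A w == A u) && (B w == B u).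

Lemma stable_exists u :
  exists z, [/\ R u z, B z = B u & forall y, R z y -> B y = B u -> A y = A z].
Proof.
(* The variable types still visible from [u] at points of the same modal type are counted. If the
   point [z] given by [mgrz] is not stable, some [y] above it has left the type of [u] for good, and
   the count drops. *)
pose sees u a := `[< exists y, [/\ R u y, A y = a & B y = B u] >].
pose f u := count (sees u) (bits (size P)).
elim: {u}(f u).+1 {-2}u (ltnSn (f u)) => // k IH u; rewrite ltnS => uk.
have : m u (chi (A u) (B u)) by rewrite chiP !eqxx.
case/mgrz => z [uz]; rewrite chiP => /andP[/eqP Az /eqP Bz] zmax.
case: (pselect (forall y, R z y -> B y = B u -> A y = A z)); first by exists z.
move=> /existsNP[y] /not_implyP[zy] /not_implyP[By /eqP]; rewrite Az => Ay.
have uy := Rtrans uz zy.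
have nsee : ~~ sees y (A u).
  apply/asboolPn => -[t [yt At Bt]]; move: Ay.
  have : m y (chi (A u) (B u)).
    by apply: zmax => //; exists t; rewrite // chiP At Bt By !eqxx.
  by rewrite chiP => /andP[->].
have lt : f y < f u.
  have us : sees u (A u) by apply/asboolP; exists u.
  apply: (count_lt (x := A u)) => //; last by rewrite mem_bits size_map.
  move=> a /asboolP[t [yt At Bt]]; apply/asboolP; exists t; split=> //.
    exact: Rtrans uy yt.
  by rewrite Bt.
have [|z' [yz' Bz' st]] := IH y; first exact: leq_trans lt uk.
exists z'; split; [exact: Rtrans uy yz'|by rewrite Bz' By|].
by move=> t zt Bt; apply: st => //; rewrite Bt By.
Qed.

(** First [mgrz] gives [z] for [psi], then a stable [z'] of the same modal type is taken above it.
    The modal type decides whether [psi] is visible, so [psi] is visible from [z'] and therefore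
    holds there. *)
Lemma peak_exists psi u : m u psi ->
  (forall y z, B y = B z ->
     (exists2 t, R y t & m t psi) -> exists2 t, R z t & m t psi) ->
  exists z, [/\ R u z, m z psi & forall y, R z y -> B y = B z -> A y = A z].
Proof.
case/mgrz => z [uz zpsi zmax] Bsees.
have [z' [zz' Bz' st]] := stable_exists z.
exists z'; split; first exact: Rtrans uz zz'.
  by apply: zmax => //; apply: (Bsees z) => //; exists z.
by move=> y; rewrite Bz'; apply: st.
Qed.

End Peaks.

(** * Types of worlds and the modal redefinition of variables *)

Fixpoint literals (l : seq tform) (b : bitseq) : tform :=
  if l is x :: l'
  then tAnd (if head false b then x else tNeg x) (literals l' (behead b))
  else tTop.

Definition is_var (a : tform) := if a is tVar _ then true else false.

Definition is_modal (a : tform) :=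
  match a with tBoxF _ | tDiaP _ => true | _ => false end.

Fixpoint subforms (a : tform) : seq tform :=
  a :: match a with
  | tNeg a | tBoxF a | tDiaP a => subforms a
  | tAnd a b | tOr a b => subforms a ++ subforms b
  | _ => [::]
  end.

Section Types.
Variable S : seq tform.

Definition vars := [seq a <- S | is_var a].
Definition mods := [seq a <- S | is_modal a].

(* The type of a world is the pair (A, B) of the truth values of the variables
   and of the modal formulae of S at that world. *)
Definition type_atom (A B : bitseq) (a : tform) : bool :=
  if is_var a then nth false A (index a vars) else nth false B (index a mods).

Definition type_val (A B : bitseq) : tform -> bool := tval (type_atom A B).

(* The part of reflexivity visible in a single type. *)
Definition locally_ok (A B : bitseq) : bool :=
  all (fun a => match a with
    | tBoxF b => type_val A B a ==> type_val A B b
    | tDiaP b => type_val A B b ==> type_val A B a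
    | _ => true end) mods.

(** Some variable type compatible with [B]. The fallback [[::]] does not arise for modal types
    realized in a model, whose own variable type is a candidate. *)
Definition default_vars (B : bitseq) : bitseq :=
  head [::] [seq A <- bits (size vars) | locally_ok A B].

Definition type_form (A B : bitseq) : tform := tAnd (literals vars A) (literals mods B).

(** At a world of modal type [B] this says that all worlds above, or all worlds below, of that modal
    type have variable type [A]; by reflexivity [A] is then the world's own type. *)
Definition stable_form (A B : bitseq) : tform :=
  let c := tImp (literals mods B) (literals vars A) in tOr (tBoxF c) (tBoxP c).

(* Given that the modal type of the world is B: the n-th variable holds in its
   stable type, or there is no stable type and it holds by default. *)
Definition modal_var_at (n : nat) (B : bitseq) : tform :=
  let i := index (tVar n) vars in
  tOr (tdisj [seq stable_form A B | A <- bits (size vars) & nth false A i])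
      (tAnd (if nth false (default_vars B) i then tTop else tBot)
         (tNeg (tdisj [seq stable_form A B | A <- bits (size vars)]))).

(** Every variable occurs here under a modality, so that the formula is a Boolean combination of
    modal ones. *)
Definition modal_var (n : nat) : tform :=
  tdisj [seq tAnd (literals mods B) (modal_var_at n B) | B <- bits (size mods)].

Section Eval.
Variables (W : Type) (R : W -> W -> Prop) (m : W -> tform -> bool).
Hypothesis mR : tmodel R m.
Local Notation A w := (map (m w) vars).
Local Notation B w := (map (m w) mods).

Lemma literalsP l w b : size b = size l -> m w (literals l b) = (map (m w) l == b).
Proof.
elim: l b => [|x l IH] [|b0 b] //=; first by rewrite (tm_top mR).
case=> sb.
rewrite (tm_and mR) IH // eqseq_cons; congr andb.
by case: b0; rewrite ?(tm_neg mR); case: (m w x).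
Qed.

Lemma type_formP u w : m w (type_form (A u) (B u)) = (A w == A u) && (B w == B u).
Proof. by rewrite (tm_and mR) !literalsP ?size_map. Qed.

Lemma tm_disj w l : m w (tdisj l) = has (m w) l.
Proof. by rewrite (tm_tval mR) tval_disj; apply: eq_has => x; rewrite -(tm_tval mR). Qed.

Definition stable w : Prop :=
  (forall v, R w v -> B v = B w -> A v = A w) \/
  (forall v, R v w -> B v = B w -> A v = A w).

Definition new_vars w : bitseq := if `[< stable w >] then A w else default_vars (B w).

Lemma stable_formP w : m w (stable_form (A w) (B w)) = `[< stable w >].
Proof.
rewrite (tm_or mR); apply/orP/asboolP => -[st|st]; [left|right|left|right].
- move=> v wv Bv; have := proj1 (tm_boxF mR _ _) st v wv.
  by rewrite (tm_imp mR) !literalsP ?size_map // Bv eqxx => /eqP.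
- move=> v wv Bv; have := proj1 (tm_boxP mR _ _) st v wv.
  by rewrite (tm_imp mR) !literalsP ?size_map // Bv eqxx => /eqP.
- apply/(tm_boxF mR) => v wv; rewrite (tm_imp mR) !literalsP ?size_map //.
  by apply/implyP => /eqP Bv; apply/eqP/st.
- apply/(tm_boxP mR) => v wv; rewrite (tm_imp mR) !literalsP ?size_map //.
  by apply/implyP => /eqP Bv; apply/eqP/st.
Qed.

Lemma stable_form_eq w a : size a = size vars -> m w (stable_form a (B w)) -> a = A w.
Proof.
move=> sa; rewrite (tm_or mR) => st.
have : m w (tImp (literals mods (B w)) (literals vars a)).
  case/orP: st => [/(tm_boxF mR)|/(tm_boxP mR)]; apply; exact: tm_refl mR w.
by rewrite (tm_imp mR) !literalsP ?size_map // eqxx => /eqP.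
Qed.

Lemma has_stable_form w (p : pred bitseq) :
  has (m w) [seq stable_form a (B w) | a <- bits (size vars) & p a]
  = `[< stable w >] && p (A w).
Proof.
apply/hasP/andP => [[x /mapP[a]]|[st pA]].
  rewrite mem_filter mem_bits => /andP[pa /eqP sa] {x}-> st.
  by have Ea := stable_form_eq sa st; rewrite -stable_formP -{1}Ea st -Ea.
exists (stable_form (A w) (B w)); last by rewrite stable_formP.
by apply: map_f; rewrite mem_filter pA mem_bits size_map /=.
Qed.

Lemma modal_varP w n : m w (modal_var n) = nth false (new_vars w) (index (tVar n) vars).
Proof.
set i := index _ _.
have FE : m w (modal_var_at n (B w)) = nth false (new_vars w) i.
  rewrite (tm_or mR) (tm_and mR) (tm_neg mR) !tm_disj has_stable_form.
  rewrite -[bits _]filter_predT has_stable_form /new_vars andbT -/i.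
  have -> : m w (if nth false (default_vars (B w)) i then tTop else tBot) =
    nth false (default_vars (B w)) i.
    by case: nth; [exact: tm_top mR w|exact: tm_bot mR w].
  by case: asboolP => _ /=; rewrite ?andbF ?orbF ?andbT.
rewrite -FE tm_disj; apply/hasP/idP => [[x /mapP[b]]|Fw].
  rewrite mem_bits => /eqP sb {x}->; rewrite (tm_and mR) literalsP //.
  by move=> /andP[/eqP ->].
exists (tAnd (literals mods (B w)) (modal_var_at n (B w))).
  by apply/mapP; exists (B w); rewrite // mem_bits size_map.
by rewrite (tm_and mR) literalsP ?size_map // eqxx.
Qed.

Lemma type_atomP w a : a \in S -> is_var a || is_modal a ->
  type_atom (A w) (B w) a = m w a.
Proof.
move=> aS; rewrite /type_atom; case: ifP => [va _|nva /= ma];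
  rewrite (nth_map tBot) ?nth_index ?index_mem ?mem_filter ?aS ?va ?ma //.
Qed.

Lemma type_valP a w : {subset subforms a <= S} -> type_val (A w) (B w) a = m w a.
Proof.
rewrite /type_val.
elim: a => [n|||a IH|a IHa b IHb|a IHa b IHb|a _|a _] sub /=.
- by rewrite type_atomP // sub // mem_head.
- by rewrite (tm_bot mR).
- by rewrite (tm_top mR).
- by rewrite (tm_neg mR) IH // => x xa; apply: sub; rewrite inE xa orbT.
- rewrite (tm_and mR) IHa ?IHb // => x xa; apply: sub; rewrite inE mem_cat xa ?orbT //.
- rewrite (tm_or mR) IHa ?IHb // => x xa; apply: sub; rewrite inE mem_cat xa ?orbT //.
- by rewrite type_atomP // sub // mem_head.
- by rewrite type_atomP // sub // mem_head.
Qed.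

Hypothesis Ssub : forall a, a \in S -> {subset subforms a <= S}.
Hypothesis mgrzF : grz_on R m.
Hypothesis mgrzP : grz_on (fun u v => R v u) m.

Lemma subform_refl a : a \in subforms a. Proof. by case: a => *; exact: mem_head. Qed.

Lemma type_locally_ok w : locally_ok (A w) (B w).
Proof.
apply/allP => a; rewrite mem_filter => /andP[ma aS].
have sub := Ssub aS; case: a ma {aS} sub => // a _ sub;
  have suba : {subset subforms a <= S} by move=> x xa; apply: sub; rewrite inE xa orbT.
all: rewrite !type_valP //; apply/implyP.
  by move/(tm_boxF mR); apply; exact: tm_refl mR w.
by move=> wa; apply/(tm_diaP mR); exists w => //; exact: tm_refl mR w.
Qed.

Lemma new_vars_locally_ok w : locally_ok (new_vars w) (B w).
Proof.
rewrite /new_vars; case: asboolP => _; first exact: type_locally_ok.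
have : A w \in [seq a <- bits (size vars) | locally_ok a (B w)].
  by rewrite mem_filter type_locally_ok mem_bits size_map /=.
rewrite /default_vars.
case E : [seq _ <- _ | _] => [//|a l] _ /=.
by have := mem_head a l; rewrite -E mem_filter => /andP[].
Qed.

Lemma new_vars_stable w : stable w -> new_vars w = A w.
Proof. by rewrite /new_vars; case: asboolP. Qed.

(** Revaluing the variables leaves the modal formulae of [S] unchanged. Local compatibility prevents
    new counterexamples to a box and new witnesses of a diamond; stable points, where nothing is
    revalued, preserve the old ones. *)
Lemma tsubst_modal_var a w : {subset subforms a <= S} ->
  m w (tsubst modal_var a) = type_val (new_vars w) (B w) a.
Proof.
have typeB v u x : B v = B u -> x \in S -> is_modal x -> m v x = m u x.
  by move=> Bvu xS mx; have /eq_in_map := Bvu; apply; rewrite mem_filter mx.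
have mod_val x v : x \in S -> is_modal x -> type_val (new_vars v) (B v) x = m v x.
  move=> xS mx; rewrite -(type_atomP v xS) ?mx ?orbT //.
  by case: x mx {xS}.
elim: a w => [n|||a IH|a IHa b IHb|a IHa b IHb|a IH|a IH] w sub.
- by rewrite /= modal_varP.
- by rewrite /= (tm_bot mR).
- by rewrite /= (tm_top mR).
- by rewrite /= (tm_neg mR) IH // => x xa; apply: sub; rewrite inE xa orbT.
- rewrite /= (tm_and mR) IHa ?IHb // => x xa; apply: sub; rewrite inE mem_cat xa ?orbT //.
- rewrite /= (tm_or mR) IHa ?IHb // => x xa; apply: sub; rewrite inE mem_cat xa ?orbT //.
- have aS : tBoxF a \in S by exact/sub/subform_refl.
  have suba : {subset subforms a <= S} by move=> x xa; apply: sub; rewrite inE xa orbT.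
  rewrite mod_val //=; apply/idP/idP => [/(tm_boxF mR) all_a|wa]; last first.
    apply/(tm_boxF mR) => v wv; rewrite IH //.
    have := allP (new_vars_locally_ok v) (tBoxF a).
    rewrite mem_filter aS => /(_ isT); rewrite mod_val // => /implyP; apply.
    apply/(tm_boxF mR) => u vu; apply: (proj1 (tm_boxF mR w a) wa).
    exact: (tm_trans mR wv vu).
  apply: contraT => nwa.
  have [u wu nua] : exists2 u, R w u & m u (tNeg a).
    apply: contrapT => no; move/negP: nwa; apply; apply/(tm_boxF mR) => u wu.
    by apply: contraT; rewrite -(tm_neg mR) => nua; case: no; exists u.
  (* Whether [tNeg a] is visible depends only on the modal type, because [tBoxF a] belongs to
     [S]. *)
  have dual v : (exists2 t, R v t & m t (tNeg a)) <-> ~~ m v (tBoxF a).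
    split=> [[t vt]|nv].
      by rewrite (tm_neg mR); apply: contra => /(tm_boxF mR); exact.
    apply: contrapT => no; move/negP: nv; apply; apply/(tm_boxF mR) => t vt.
    by apply: contraT; rewrite -(tm_neg mR) => nt; case: no; exists t.
  have seesB y z : B y = B z -> (exists2 t, R y t & m t (tNeg a)) ->
      exists2 t, R z t & m t (tNeg a).
    by move=> Byz /dual nya; apply/dual; rewrite -(typeB _ _ _ Byz aS isT).
  have [z [uz nza st]] :=
    peak_exists (tm_refl mR) (tm_trans mR) mgrzF type_formP nua seesB.
  have zst : stable z by left=> v zv Bv; apply: st.
  have := all_a z (tm_trans mR wu uz).
  by rewrite IH // new_vars_stable // type_valP // -[m z a]negbK -(tm_neg mR) nza.
- have aS : tDiaP a \in S by exact/sub/subform_refl.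
  have suba : {subset subforms a <= S} by move=> x xa; apply: sub; rewrite inE xa orbT.
  rewrite mod_val //=; apply/idP/idP => [/(tm_diaP mR)[v vw]|wa].
    rewrite IH // => va.
    have := allP (new_vars_locally_ok v) (tDiaP a).
    rewrite mem_filter aS => /(_ isT); rewrite (mod_val (tDiaP a)) // va /=.
    move=> /(tm_diaP mR)[u uv ua].
    by apply/(tm_diaP mR); exists u => //; exact: (tm_trans mR uv vw).
  have [u uw ua] := proj1 (tm_diaP mR w a) wa.
  (* The past case applies the peak argument to the converse relation. *)
  have Rt' v x y : R v x -> R y v -> R y x by move=> vx yv; exact: (tm_trans mR yv vx).
  have seesB y z : B y = B z -> (exists2 t, R t y & m t a) ->
      exists2 t, R t z & m t a.
    move=> Byz /(tm_diaP mR) ya; apply/(tm_diaP mR).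
    by rewrite -(typeB _ _ _ Byz aS isT).
  have [z [uz za st]] := peak_exists (R := fun u v => R v u)
    (tm_refl mR) Rt' mgrzP type_formP ua seesB.
  have zst : stable z by right=> v zv Bv; apply: st.
  apply/(tm_diaP mR); exists z; first exact: (tm_trans mR uz uw).
  by rewrite IH // new_vars_stable // type_valP.
Qed.

End Eval.
End Types.

(* Locked, since simplification would try to compute the code. *)
Definition encode_var : tform -> nat := locked choice.pickle.

Definition decode_var (n : nat) : tform := odflt tBot (choice.unpickle n).

Arguments decode_var : simpl never.

Lemma encode_varK : cancel encode_var decode_var.
Proof. by move=> a; rewrite /decode_var /encode_var -lock choice.pickleK. Qed.

(** Only modalized formulae will be abstracted, so the value [tBot] on a bare variable is
    arbitrary. *)
Fixpoint abstract_modal (a : tform) : tform :=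
  match a with
  | tVar _ => tBot
  | tBot => tBot
  | tTop => tTop
  | tNeg a => tNeg (abstract_modal a)
  | tAnd a b => tAnd (abstract_modal a) (abstract_modal b)
  | tOr a b => tOr (abstract_modal a) (abstract_modal b)
  | tBoxF _ | tDiaP _ => tVar (encode_var a)
  end.

Fixpoint modalized (a : tform) : bool :=
  match a with
  | tVar _ => false
  | tNeg a => modalized a
  | tAnd a b | tOr a b => modalized a && modalized b
  | _ => true
  end.

Lemma modalized_disj l : modalized (tdisj l) = all modalized l.
Proof. by elim: l => //= a l ->. Qed.

Lemma modalized_literals l b : all is_modal l -> modalized (literals l b).
Proof.
elim: l b => //= a l IH b /andP[ma ml]; rewrite IH // andbT.
by case: head; case: a ma.
Qed.

Lemma modalized_modal_var S n : modalized (modal_var S n).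
Proof.
have stab (p : pred bitseq) B : all modalized
    [seq stable_form S A B | A <- bits (size (vars S)) & p A].
  by apply/allP => _ /mapP[A _ ->].
rewrite modalized_disj; apply/allP => _ /mapP[B _ ->] /=.
rewrite modalized_literals ?filter_all // !modalized_disj stab /=.
rewrite -[X in map _ X]filter_predT stab andbT.
by case: ifP.
Qed.

(** Boxing the coding variables is harmless, because [tBoxF b] and [tDiaP b] both persist along the
    transitive relation [R]. *)
Lemma abstract_modalK W (R : W -> W -> Prop) m a w : tmodel R m -> modalized a ->
  m w (tsubst decode_var (box_vars (abstract_modal a))) = m w a.
Proof.
move=> mR; elim: a => [n|||a IH|a IHa b IHb|a IHa b IHb|a _|a _] //= ma.
- by rewrite !(tm_neg mR) IH.
- by case/andP: ma => ma mb; rewrite !(tm_and mR) IHa ?IHb.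
- by case/andP: ma => ma mb; rewrite !(tm_or mR) IHa ?IHb.
- rewrite encode_varK; apply/idP/idP => [/(tm_boxF mR)|/(tm_boxF mR) wa].
    by apply; exact: tm_refl mR w.
  apply/(tm_boxF mR) => v wv; apply/(tm_boxF mR) => u vu.
  exact/wa/(tm_trans mR wv).
- rewrite encode_varK; apply/idP/idP => [/(tm_boxF mR)|/(tm_diaP mR)[v vw va]].
    by apply; exact: tm_refl mR w.
  apply/(tm_boxF mR) => u wu; apply/(tm_diaP mR); exists v => //.
  exact: (tm_trans mR vw).
Qed.

Lemma subforms_closed a b : b \in subforms a -> {subset subforms b <= subforms a}.
Proof.
elim: a b => [n|||a IH|a IHa c IHc|a IHa c IHc|a IH|a IH] b;
  rewrite /= in_cons => /orP[/eqP->|] //.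
- by move=> /IH sub x /sub; rewrite inE orbC => ->.
- rewrite mem_cat => /orP[/IHa|/IHc] sub x /sub; rewrite inE mem_cat => ->;
  by rewrite ?orbT.
- rewrite mem_cat => /orP[/IHa|/IHc] sub x /sub; rewrite inE mem_cat => ->;
  by rewrite ?orbT.
- by move=> /IH sub x /sub; rewrite inE orbC => ->.
- by move=> /IH sub x /sub; rewrite inE orbC => ->.
Qed.

(* The tense analogue of the main lemma of the Blok-Esakia theorem. *)
Lemma boxed_equivalent (fs : seq tform) : exists s e,
  forall W (R : W -> W -> Prop) m, tmodel R m -> grz_on R m ->
    grz_on (fun u v => R v u) m ->
  forall a, a \in fs ->
    (forall w, m w a) <-> (forall w, m w (tsubst e (box_vars (tsubst s a)))).
Proof.
(* Closing under subformulae of [tBoxF a] puts [tBoxF a] itself among the modal formulae whose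
   values are preserved; this yields the global equivalence. *)
pose S := flatten [seq subforms (tBoxF a) | a <- fs].
pose s n := abstract_modal (modal_var S n); exists s, decode_var.
move=> W R m mR gF gP a afs.
have aS : {subset subforms (tBoxF a) <= S}.
  by move=> x xa; apply/flattenP; exists (subforms (tBoxF a)) => //; apply/mapP; exists a.
have Scl b : b \in S -> {subset subforms b <= S}.
  move=> /flattenP[_ /mapP[c cfs ->] bc] x /(subforms_closed bc) xc.
  by apply/flattenP; exists (subforms (tBoxF c)) => //; apply/mapP; exists c.
have E b w : m w (tsubst decode_var (box_vars (tsubst s b))) =
    m w (tsubst (modal_var S) b).
  elim: b w => [n|||b IH|b IHb c IHc|b IHb c IHc|b IH|b IH] w //=.
  - by rewrite (abstract_modalK w mR (modalized_modal_var S n)).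
  - by rewrite !(tm_neg mR) IH.
  - by rewrite !(tm_and mR) IHb IHc.
  - by rewrite !(tm_or mR) IHb IHc.
  - by apply/idP/idP => /(tm_boxF mR) wb; apply/(tm_boxF mR) => v /wb; rewrite IH.
  - by apply/idP/idP => /(tm_diaP mR)[v vw vb]; apply/(tm_diaP mR);
      exists v; rewrite ?IH // -IH.
have box w : m w (tBoxF (tsubst (modal_var S) a)) = m w (tBoxF a).
  rewrite -[tBoxF _]/(tsubst (modal_var S) (tBoxF a)).
  rewrite (tsubst_modal_var mR Scl gF gP w aS).
  by rewrite -(type_valP mR w aS) /type_val /= /type_atom.
split=> wa w.
- rewrite E; have : m w (tBoxF a) by apply/(tm_boxF mR).
  by rewrite -box => /(tm_boxF mR); apply; exact: tm_refl mR w.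
- have : m w (tBoxF (tsubst (modal_var S) a)) by apply/(tm_boxF mR) => v _; rewrite -E.
  by rewrite box => /(tm_boxF mR); apply; exact: tm_refl mR w.
Qed.

(** * Every companion lies below the greatest one *)

Lemma tl_join_tense_logic X Z : tense_logic (tl_join X Z).
Proof.
split.
- by move=> s a La Y Yn; apply: (tl_subst Yn.1); apply: La.
- by move=> a Sa Y Yn; apply: (tl_S4t Yn.1).
- by move=> a b La Lab Y Yn; apply: (tl_mp Yn.1) (La _ Yn) (Lab _ Yn).
- by move=> a La Y Yn; apply: (tl_necF Yn.1) (La _ Yn).
- by move=> a La Y Yn; apply: (tl_necP Yn.1) (La _ Yn).
Qed.

Lemma GRZT_grz_on W (R : W -> W -> Prop) m : tmodel R m ->
  (forall a, GRZT a -> forall w, m w a) -> grz_on R m /\ grz_on (fun u v => R v u) m.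
Proof.
move=> mR mG.
have GF : GRZT GRZ_F.
  by move=> Y [_ YG]; apply: YG; left; move=> Z [_ ZG]; apply: ZG; right.
have GP : GRZT GRZ_P by move=> Y [_ YG]; apply: YG; right.
split=> a w wa.
(* Contraposing the instance of [GRZ_F] at [tNeg a] produces the required point where [a] holds. *)
- have := mG _ (tl_subst (tl_join_tense_logic _ _) (fun=> tNeg a) GF) w.
  rewrite /= (tm_imp mR) (tm_neg mR) wa implybF => /negP nb.
  apply: contrapT => no; apply: nb; apply/(tm_boxF mR) => z wz.
  rewrite (tm_imp mR) (tm_neg mR); apply/implyP => /(tm_boxF mR) zb.
  apply/negP => za; apply: no; exists z; split=> // y zy [t yt ta].
  apply: contraT => nya; have := zb y zy.
  rewrite (tm_imp mR) (tm_neg mR) nya /= => /(tm_boxF mR)/(_ t yt).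
  by rewrite (tm_neg mR) ta.
- have := mG _ (tl_subst (tl_join_tense_logic _ _) (fun=> a) GP) w.
  rewrite /= (tm_imp mR) wa => /(tm_diaP mR)[z zw].
  rewrite (tm_and mR) (tm_neg mR) => /andP[za /negP nz].
  exists z; split=> // y yz [t ty ta]; apply: contraT => nya; case: nz.
  apply/(tm_diaP mR); exists y; rewrite // (tm_and mR) (tm_neg mR) nya andbT.
  by apply/(tm_diaP mR); exists t.
Qed.

Section Theory.
Variables (Y : set tform) (Yt : ttheory Y).

Lemma ttheory_T_bform_of a : Y (T (bform_of a)) <-> Y (box_vars a).
Proof.
have [W [R [m [mR YE]]]] := ttheory_model Yt.
by rewrite !YE; apply: T_bform_of_global mR a.
Qed.

Lemma ttheory_subst_T_bform_of s a :
  Y (tsubst s (T (bform_of a))) <-> Y (tsubst s (box_vars a)).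
Proof.
have [W [R [m [mR YE]]]] := ttheory_model Yt.
by rewrite !YE; apply: (T_bform_of_global (tmodel_subst s mR) a).
Qed.

End Theory.

(** The substitutions are fixed before [Y], so a single bi-formula for each [a] serves all theories
    above [GRZT]. *)
Lemma ttheory_boxed_equivalent (fs : seq tform) : exists s e,
  forall Y, ttheory Y -> GRZT `<=` Y ->
  forall a, a \in fs -> Y a <-> Y (tsubst e (T (bform_of (tsubst s a)))).
Proof.
have [s [e H]] := boxed_equivalent fs; exists s, e => Y Yt YG a afs.
rewrite ttheory_subst_T_bform_of //.
have [W [R [m [mR YE]]]] := ttheory_model Yt.
have [|gF gP] := GRZT_grz_on mR; first by move=> b /YG/YE.
rewrite !YE; exact: (H W R m mR gF gP a afs).
Qed.

Theorem companion_logic_sub_sigma L M :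
  tense_companion_logic L M -> M `<=` sigma_logic L.
Proof.
case=> Ml LM a Ma.
have [s [e H]] := ttheory_boxed_equivalent [:: a].
have sl := tl_join_tense_logic GRZT (T @` L).
have GY : GRZT `<=` sigma_logic L by move=> b Gb Y [_]; apply; left.
have aa : a \in [:: a] by rewrite mem_head.
have [_] := H _ (tense_logic_theory sl) GY a aa; apply; apply: (tl_subst sl).
(* [M] need not contain [GRZT]: it contains the boxed instance of [a] by substitution, and over S4.t
   this is interchangeable with a translation. *)
move=> Y [_]; apply; right; exists (bform_of (tsubst s a)) => //.
have [_] := ttheory_T_bform_of (tense_logic_theory Ml) (tsubst s a).
by move=> H'; apply/LM/H'; do 2!apply: (tl_subst Ml).
Qed.

Lemma tense_rule_system_ext (M : set (rule tform)) r : tense_rule_system M -> ~ M r ->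
  exists Y : set tform, [/\ ttheory Y, forall a, a \in r.1 -> Y a,
    forall a, a \in r.2 -> ~ Y a
    & forall q, M q -> (forall a, a \in q.1 -> Y a) -> exists2 d, d \in q.2 & Y d].
Proof.
move=> Ml /(rule_system_ext (tl_rs Ml))[Y [YG YD YM]].
exists Y; split=> //; last by move=> a /YD/negP.
split.
- by move=> a /(tl_rs_S4t Ml)/YM[|d]; rewrite /= ?inE // => /eqP ->.
- move=> a b Ya Yab; have [|d] := YM _ (tl_rs_mp Ml a b); rewrite /= ?inE //.
    by move=> c; rewrite !inE => /orP[]/eqP->.
  by move=> /eqP->.
- move=> a Ya; have [|d] := YM _ (tl_rs_necF Ml a); rewrite /= ?inE //.
    by move=> c; rewrite !inE => /eqP->.
  by move=> /eqP->.
- move=> a Ya; have [|d] := YM _ (tl_rs_necP Ml a); rewrite /= ?inE //.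
    by move=> c; rewrite !inE => /eqP->.
  by move=> /eqP->.
Qed.

Lemma tl_rs_join_tense_rule_system X Z : tense_rule_system (tl_rs_join X Z).
Proof.
split; first split.
- by move=> s r Lr Y Yn; apply: (rs_subst (tl_rs Yn.1)); apply: Lr.
- by move=> a Y Yn; apply: (rs_refl (tl_rs Yn.1)).
- by move=> G G' D D' Lr Y Yn; apply: (rs_weak (tl_rs Yn.1)); apply: Lr.
- by move=> G D a L1 L2 Y Yn;
  apply: (rs_cut (tl_rs Yn.1) (a := a)); [apply: L1|apply: L2].
- by move=> a Sa Y Yn; apply: (tl_rs_S4t Yn.1).
- by move=> a b Y Yn; apply: (tl_rs_mp Yn.1).
- by move=> a Y Yn; apply: (tl_rs_necF Yn.1).
- by move=> a Y Yn; apply: (tl_rs_necP Yn.1).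
Qed.

Lemma sigma_rs_T L r : L r -> sigma_rs L (map_rule T r).
Proof.
move=> Lr Y [_ YS]; apply: YS; right => Z [_ ZS]; apply: ZS; right.
by exists r.
Qed.

Lemma sigma_rs_GRZT L a : GRZT a -> sigma_rs L (axiom_rule a).
Proof.
move=> Ga Y [_ YS]; apply: YS; left => Z [_ ZS]; apply: ZS.
by exists a.
Qed.

Theorem companion_rs_sub_sigma L M :
  tense_companion_rs L M -> M `<=` sigma_rs L.
Proof.
case=> Ml LM [G D] MGD; apply: contrapT => nsig.
have sl := tl_rs_join_tense_rule_system (rs_of_logic GRZT) (tau_rs L).
have [Y [Yt YG YD YL]] := tense_rule_system_ext sl nsig.
(* Premises and conclusions are treated together, since the same two substitutions must serve the
   whole rule. *)
have [s [e H]] := ttheory_boxed_equivalent (enum_fset (G `|` D)%fset).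
have GY : GRZT `<=` Y.
  by move=> a /(@sigma_rs_GRZT L)/YL[|d]; rewrite /= ?inE // => /eqP ->.
have {}H a : a \in (G `|` D)%fset -> Y a <-> Y (tsubst e (T (bform_of (tsubst s a)))).
  by move=> aGD; apply: H.
pose rho := map_rule (fun a => bform_of (tsubst s a)) (G, D).
(* A theory of [M] refuting the translation of [rho] would refute a substitution instance of the
   rule [(G, D)] of [M]. *)
have Lrho : L rho.
  apply/LM; apply: contrapT => nrho.
  have [Z [Zt ZG ZD ZM]] := tense_rule_system_ext Ml nrho.
  have Mb := rs_subst (tl_rs Ml) (fun n => tBoxF (tVar n)) (rs_subst (tl_rs Ml) s MGD).
  have [a|d] := ZM _ Mb.
    move=> /imfsetP[_ /imfsetP[b bG ->] ->].
    apply/ttheory_T_bform_of => //; apply: ZG.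
    by apply/imfsetP; exists (bform_of (tsubst s b)) => //; apply/imfsetP; exists b.
  move=> /imfsetP[_ /imfsetP[b bD ->] ->] /(ttheory_T_bform_of Zt); apply: ZD.
  by apply/imfsetP; exists (bform_of (tsubst s b)) => //; apply/imfsetP; exists b.
(* The [e]-instance of the translated [rho] lies in [sigma_rs L], and over [Y] it amounts to the
   original rule, which [Y] refutes. *)
have [a|d] := YL _ (rs_subst (tl_rs sl) e (sigma_rs_T Lrho)).
  move=> /imfsetP[_ /imfsetP[_ /imfsetP[b /= bG ->] ->] ->].
  have bGD : b \in (G `|` D)%fset by rewrite in_fsetU bG.
  by apply/(H b bGD)/YG.
move=> /imfsetP[_ /imfsetP[_ /imfsetP[b /= bD ->] ->] ->].
have bGD : b \in (G `|` D)%fset by rewrite in_fsetU bD orbT.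
by move/(proj2 (H b bGD)); apply: YD.
Qed.

Theorem theorem4p44 :
  (forall L : set (rule bform), bsi_rule_system L ->
     [set M | tense_companion_rs L M] =
     [set M | [/\ tense_rule_system M, tau_rs L `<=` M & M `<=` sigma_rs L]])
  /\
  (forall L : set bform, bsi_logic L ->
     [set M | tense_companion_logic L M] =
     [set M | [/\ tense_logic M, tau_logic L `<=` M & M `<=` sigma_logic L]]).

Proof.
split=> L Ll; rewrite eqEsubset; split=> M /=.
- move=> LM; split; [exact: LM.1| |exact: companion_rs_sub_sigma].
  apply: smallest_sub; first exact: LM.1.
  move=> r [|[q Lq <-]]; last exact/LM.2.
  apply: smallest_sub; first exact: LM.1.
  by move=> _ [a Sa <-]; apply: tl_rs_S4t LM.1 _ _.
(* The lower bound gives preservation of rules under [T], and the upper bound reduces reflection to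
   conservativity. *)
- case=> Ml tM Ms; split=> // r; split=> [Lr|/Ms]; last exact: sigma_rs_conservative.
  by apply: tM => Y [_]; apply; right; exists r.
- move=> LM; split; [exact: LM.1| |exact: companion_logic_sub_sigma].
  apply: smallest_sub; first exact: LM.1.
  by move=> a [/(tl_S4t LM.1)//|[b Lb <-]]; apply/LM.2.
- case=> Ml tM Ms; split=> // a; split=> [La|/Ms]; last exact: sigma_logic_conservative.
  by apply: tM => Y [_]; apply; right; exists a.
Qed.
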